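(* There is a universal constant $D_o$ such that the following holds. Assume (A1)--(A3), and let $f:[0,\tau]\times\mathcal{Z}\to\mathbb{R}$ be measurable with $\|f\|_\infty\le M$, where $M>0$. Then for every $n\ge1$ and $\eta>0$, $$P\left(\frac{\sqrt n\,\hat H_\tau\hat G_\tau^2}{M}\left|\hat\mu_n(f)-\mu(f)\right|\ge4\sqrt{2\eta}+3D_o\right)\le\frac{11}{2}e^{-\eta}.$$
   Context: Let $\tau>0$ be a finite constant and $\mathcal{Z}\subset\mathbb{R}^d$. $T$ is a failure time, $Z$ is a random vector with values in $\mathcal{Z}$, and $C\ge 0$ is a censoring time. Put $U=\min\{T,C\}$ and $\delta=\mathbf{1}\{T\le C\}$. The observed data are $(U_i,\delta_i,Z_i)$, $i=1,\dots,n$, i.i.d. copies of $(U,\delta,Z)$, with underlying $T_i,C_i$. $P$ denotes probability and also expectation. $S(t)=P(T>t)$, $G(t)=P(C>t)$, $H(t)=P(U>t)$; for a function $g$, $g(t-)$ is its left limit at $t$. Assumptions: (A1) the pair $(T,Z)$ is independent of $C$. (A2) $T$ takes values in $[0,\tau]$, and $H(\tau-)=P(U\ge\tau)>0$. (A3) $P(T=C)=0$. Kaplan--Meier estimator of $G$ (product over distinct observed times $s\le t$ among the $U_i$): $\hat G_n(t)=\prod_{s\le t}\left(1-\frac{\#\{i:U_i=s,\delta_i=0\}}{\#\{i:U_i\ge s\}}\right)$. Notation: $\hat G_\tau=\hat G_n(\tau-)$, $\hat H_\tau=\frac1n\sum_{i=1}^n\mathbf{1}\{U_i\ge\tau\}$.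 $\mu(f)=P[f(T,Z)]$, and $\hat\mu_n(f)=\frac1n\sum_{i=1}^n\frac{\delta_i f(T_i,Z_i)}{\hat G_n(T_i-)}$ (terms with $\delta_i=0$ are zero; when $\delta_i=1$, $T_i=U_i$). ''Universal'' means not depending on $n,\eta,M,f$ or the distributions of $T,Z,C$. In the paper $D_o$ is the constant in the Dvoretzky--Kiefer--Wolfowitz-type inequality for the Kaplan--Meier estimator (Bitouzé, Laurent, Massart 1999): $P(\sqrt n\,S(\tau-)\,\|\hat G_n-G\|_\infty\ge\varepsilon)\le\frac52e^{-2\varepsilon^2+D_o\varepsilon}$ for all $n\ge1$, $\varepsilon>0$ (supremum over $[0,\tau]$). *)

(* Defs.v *)
From mathcomp Require Export all_boot all_order all_algebra.
From mathcomp Require Export all_classical all_reals all_analysis.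
Export Order.TTheory GRing.Theory Num.Theory.
Export numFieldNormedType.Exports.

Set Implicit Arguments.
Unset Strict Implicit.
Unset Printing Implicit Defensive.

Local Open Scope classical_set_scope.
Local Open Scope ring_scope.

(* R^k is represented by [k.-tuple R], whose library sigma-algebra is the
   product (= Borel) one. *)

Definition independent_RVs (R : realType) d (Omega : measurableType d)
    (P : probability Omega R) d1 (E1 : measurableType d1)
    d2 (E2 : measurableType d2) (X : Omega -> E1) (Y : Omega -> E2) : Prop :=
  forall (A : set E1) (B : set E2), measurable A -> measurable B ->
    P ((X @^-1` A) `&` (Y @^-1` B)) = (P (X @^-1` A) * P (Y @^-1` B))%E.

Definition mutually_independent (R : realType) d (Omega : measurableType d)
    (P : probability Omega R) d' (E : measurableType d') (n : nat)
    (X : 'I_n -> Omega -> E) : Prop :=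
  forall (J : {set 'I_n}) (A : 'I_n -> set E), (forall i, measurable (A i)) ->
    P (\bigcap_(i in [set i | i \in J]) (X i @^-1` A i)) =
    (\prod_(i in J) P (X i @^-1` A i))%E.

Definition identically_distributed (R : realType) d (Omega : measurableType d)
    (P : probability Omega R) d' (E : measurableType d')
    (X Y : Omega -> E) : Prop :=
  forall A : set E, measurable A -> P (X @^-1` A) = P (Y @^-1` A).

Definition iid_copies (R : realType) d (Omega : measurableType d)
    (P : probability Omega R) d' (E : measurableType d') (n : nat)
    (X : 'I_n -> Omega -> E) (X0 : Omega -> E) : Prop :=
  mutually_independent P X /\ forall i, identically_distributed P (X i) X0.

(* Measurability of the restriction of f to D, for the trace sigma-algebra on
   D. The library's [measurable_fun D f] is void when D is not measurable,
   and D is an arbitrary set here. *)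
Definition measurable_on d1 (E1 : measurableType d1) d2 (E2 : measurableType d2)
    (D : set E1) (f : E1 -> E2) : Prop :=
  forall Y : set E2, measurable Y ->
    exists2 B : set E1, measurable B & D `&` f @^-1` Y = D `&` B.

Definition observed_time (R : realType) (Omega : Type) (T C : Omega -> R)
    (w : Omega) : R := Num.min (T w) (C w).

Definition uncensored (R : realType) (Omega : Type) (T C : Omega -> R)
    (w : Omega) : bool := T w <= C w.

Definition observation (R : realType) (Omega : Type) (E : Type)
    (T C : Omega -> R) (Z : Omega -> E) (w : Omega) : R * bool * E :=
  (observed_time T C w, uncensored T C w, Z w).

Definition left_limit (R : realType) (g : R -> R) (t : R) : R :=
  lim (g x @[x --> t^'-]).

(* The product runs once over each distinct value s <= t among the u i. *)
Definition kaplan_meier_censoring (R : realType) (n : nat) (u : 'I_n -> R)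
    (delta : 'I_n -> bool) (t : R) : R :=
  \prod_(s <- undup (codom u) | s <= t)
    (1 - #|[pred i | (u i == s) && ~~ delta i]|%:R
         / #|[pred i | s <= u i]|%:R).

Definition at_risk_fraction (R : realType) (n : nat) (u : 'I_n -> R)
    (t : R) : R :=
  n%:R^-1 * #|[pred i | t <= u i]|%:R.

(* If delta i holds, the denominator is positive, because individual i is still
   at risk, and not censored, at every observed time before u i = t i. *)
Definition mu_hat (R : realType) (E : Type) (n : nat) (t u : 'I_n -> R)
    (delta : 'I_n -> bool) (z : 'I_n -> E) (f : R * E -> R) : R :=
  n%:R^-1 * \sum_(i < n)
    (delta i)%:R * f (t i, z i)
      / left_limit (kaplan_meier_censoring u delta) (t i).

(* Main.v *)
From HB Require Import structures.
Require Import Defs.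
From mathcomp Require Import all_fingroup measurable_realfun ring lra zify.

(** The estimator is analysed conditionally on the pairs (T_i, Z_i). Write a_i for
    f(T_i, Z_i), G for the Kaplan-Meier product just before tau, and S for the sum of
    the a_i. The error n (mu_hat - mu) splits into S - n mu, a sum of centred
    independent variables bounded by 2 M, and X - S, where X = n mu_hat is the
    inverse-probability-of-censoring weighted sum.

    The term X - S is the end of a martingale. Given the pairs and the multiset of
    censoring times, the assignment of these times to the individuals is a uniform
    permutation, because C is independent of (T, Z). Hand out the times in
    increasing order. If the current one goes to an individual who has already
    failed, nothing happens. Otherwise a uniform member r of the at-risk set, of
    size N, is censored; the Kaplan-Meier product is multiplied by 1 - 1/N, the
    weights of the survivors at risk are divided by this factor, and the weighted
    sum changes by (mean of a over the at-risk set - a_r) / G', with G' the new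
    product. This is centred and bounded by 2 M / G'. Hence
    exp(lam (X_m - S) - 4 lam^2 M^2 m / G_m^2), stopped when the product reaches 0, is
    a supermartingale ([compensated_mean_step]); it is studied as a sum over the
    symmetric group, where conditioning on the past is averaging over
    transpositions. Its final value is expressed by the observed data, because the
    product of the step factors telescopes to the Kaplan-Meier product
    ([km_left_km_before]); this is where ties between failure and censoring times
    must be excluded.

    With the Hoeffding bound for S - n mu this gives
    E exp(lam n (mu_hat - mu) - 4 lam^2 M^2 n / G^2 - 4 lam^2 M^2 n) <= 1 on {G > 0}.
    On the event in question |mu_hat - mu| is at least of order 1 / G^2, and the
    compensator is of order 1 / G^2 as well. One fixed lam therefore serves for all
    values of the random G, and each tail has probability at most exp(-eta)
    ([deviation_bound]).

    The data are i.i.d. only as far as the observations go. The argument takes place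
    on the n-fold product of the law of ((T, Z), C), constructed in
    [iid_power_exists]; its image under the observation map is the law of the data
    ([iid_copies_law]), and it is invariant under permutations of the censoring times
    ([iid_power_permute_snd]). *)

Set Implicit Arguments.
Unset Strict Implicit.
Unset Printing Implicit Defensive.

Local Open Scope classical_set_scope.
Local Open Scope ring_scope.

(** * An exponential inequality for centred variables *)

(** For [y <= 1], the bound [1 - y / 4 <= expR (- y / 4)] turns [expR y] into the
    rational function [(1 - y / 4) ^- 4], and [1 + y ^+ 2 / 2 <= expR (y ^+ 2 / 2)]
    turns the right-hand side into a polynomial. For a centred bounded variable
    this inequality gives a sub-Gaussian bound at once: the linear term has mean
    zero. *)
Lemma expR_le_id_add_expR_sqr (R : realType) (y : R) : expR y <= y + expR (y ^+ 2).
Proof.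
have [y1|/ltW y1] := lerP y 1; last first.
  rewrite (le_trans (_ : _ <= expR (y ^+ 2))) ?ler_expR ?ler_wpDl//; last lra.
  by rewrite expr2 ler_peMl //; lra.
have sq : (1 + y ^+ 2 / 2) ^+ 2 <= expR (y ^+ 2).
  have -> : expR (y ^+ 2) = expR (y ^+ 2 / 2) ^+ 2.
    by rewrite -expRM_natl; congr expR; field.
  rewrite lerXn2r ?nnegrE ?expR_ge0 ?expR_ge1Dx //.
  by rewrite addr_ge0 // divr_ge0 // sqr_ge0.
have q4 : (1 - y / 4) ^+ 4 <= (expR y)^-1.
  rewrite -expRN.
  have -> : expR (- y) = expR (- (y / 4)) ^+ 4.
    by rewrite -expRM_natl; congr expR; field.
  by rewrite lerXn2r ?nnegrE ?expR_ge0 ?expR_ge1Dx //; lra.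
have y0 : 0 < (1 - y / 4) ^+ 4 by rewrite exprn_gt0 //; lra.
apply: (@le_trans _ _ ((1 - y / 4) ^- 4)).
  by rewrite -[leLHS]invrK lef_pV2 // posrE ?invr_gt0 ?expR_gt0.
apply: (@le_trans _ _ (y + (1 + y ^+ 2 / 2) ^+ 2)); last by rewrite lerD2l.
rewrite -div1r ler_pdivrMr //.
rewrite -subr_ge0.
(* positivity of the coefficients after the substitution y = 1 - z *)
pose z := 1 - y.
have z0 : 0 <= z by rewrite subr_ge0.
have -> : (y + (1 + y ^+ 2 / 2) ^+ 2) * (1 - y / 4) ^+ 4 - 1 =
  y ^+ 2 * (29 + 166 * z + 87 * z ^+ 2 + 56 * z ^+ 3 + 35 * z ^+ 4
            + 10 * z ^+ 5 + z ^+ 6) / 1024.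
  by rewrite /z; field.
apply: divr_ge0; last exact: ler0n.
apply: mulr_ge0; first exact: sqr_ge0.
by do ?[exact: ler0n | exact: z0 | apply: exprn_ge0 | apply: addr_ge0 | apply: mulr_ge0].
Qed.

(** Hoeffding's lemma for the uniform law on [A]. *)
Lemma sum_expR_le_card (R : realType) (I : finType) (A : {set I}) (y : I -> R) (B : R) :
  \sum_(i in A) y i = 0 -> (forall i, i \in A -> `|y i| <= B) ->
  \sum_(i in A) expR (y i) <= #|A|%:R * expR (B ^+ 2).
Proof.
move=> y0 yB.
apply: (@le_trans _ _ (\sum_(i in A) (y i + expR (B ^+ 2)))).
  apply: ler_sum => i iA; apply: (le_trans (expR_le_id_add_expR_sqr _)).
  rewrite lerD2l ler_expR -[leLHS]real_normK ?num_real //.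
  by rewrite lerXn2r ?nnegrE // ?(le_trans _ (yB i iA)) // yB.
by rewrite big_split /= y0 add0r sumr_const mulr_natl.
Qed.

(** * The supermartingale of a random assignment of censoring times *)

Lemma prod_itv01 (R : realType) (I : Type) (r : seq I) (P : pred I) (F : I -> R) :
  (forall i, P i -> 0 <= F i <= 1) -> 0 <= \prod_(i <- r | P i) F i <= 1.
Proof.
move=> F01; elim/big_ind: _ => [|x y /andP[x0 x1] /andP[y0 y1]|i /F01 //].
  by rewrite ler01 lexx.
by rewrite mulr_ge0 // mulr_ile1.
Qed.

Section RandomAssignment.
Context (R : realType) (n : nat) (t c a : 'I_n -> R).
Implicit Types (s : 'S_n) (k l i : 'I_n).

(** The permutation [s] gives the censoring time [c (s i)] to individual [i]; with
    [c] sorted, [c k] is the [k]-th time to be handed out. [at_risk s k] is the set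
    of those who can be censored by it: they have received no time yet and have
    not failed by [c k]. *)
Definition at_risk s k : {set 'I_n} := [set i | (k <= s i)%N && (c k < t i)]%SET.

(** The denominator vanishes only if nobody is at risk; the numerator is then [0]
    too, and the factor is [1]. *)
Definition km_factor s k : R :=
  1 - (c k < t ((s^-1)%g k))%R%:R / #|at_risk s k|%:R.

Definition km_before s (m : nat) (x : R) : R :=
  \prod_(l < n | (l < m)%N && (c l < x)) km_factor s l.

Definition km_upto s (m : nat) : R := \prod_(l < n | (l < m)%N) km_factor s l.

(** The inverse-probability-of-censoring weight of [i] once the first [m] times have
    been handed out. An individual who has failed keeps a fixed weight, a censored
    one has weight [0], and all those still at risk share the weight
    [(km_upto s m)^-1]. *)
Definition ipc_weight s (m : nat) i : R :=
  (~~ ((s i < m)%N && (c (s i) < t i)%R))%:R / km_before s m (t i).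

Definition ipc_sum s (m : nat) : R := \sum_i a i * ipc_weight s m i.

Lemma at_risk_holder s k : ((s^-1)%g k \in at_risk s k) = (c k < t ((s^-1)%g k)).
Proof. by rewrite inE permKV leqnn. Qed.

Lemma km_factor_itv s k : 0 <= km_factor s k <= 1.
Proof.
rewrite /km_factor; case: ltP => [h|_]; last by rewrite mul0r subr0 ler01 lexx.
have N0 : (0 < #|at_risk s k|)%N.
  by apply/card_gt0P; exists ((s^-1)%g k); rewrite at_risk_holder.
rewrite subr_ge0 gerBl ler_pdivrMr ?ltr0n // mul1r ler1n N0 /=.
by rewrite divr_ge0.
Qed.

Lemma km_upto_itv s m : 0 <= km_upto s m <= 1.
Proof. by apply: prod_itv01 => l _; exact: km_factor_itv. Qed.

Lemma km_uptoS s k : km_upto s k.+1 = km_upto s k * km_factor s k.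
Proof.
rewrite /km_upto (bigD1 k) //= mulrC; congr (_ * _).
by apply: eq_bigl => l; rewrite ltnS -(inj_eq val_inj) /= ltn_neqAle andbC.
Qed.

Lemma km_beforeS s k x :
  km_before s k.+1 x = km_before s k x * (if c k < x then km_factor s k else 1).
Proof.
rewrite /km_before; case: ifP => ckx; last first.
  rewrite mulr1; apply: eq_bigl => l; rewrite ltnS leq_eqVlt.
  case: (l =P k :> nat) => [/val_inj ->|//] /=.
  by rewrite ckx ltnn.
rewrite (bigD1 k) /= ?ltnSn ?ckx // mulrC; congr (_ * _).
apply: eq_bigl => l; rewrite ltnS -(inj_eq val_inj) /= (ltn_neqAle l k).
by rewrite andbC andbA.
Qed.

(** Composing [s] with [tperm k (s r)] hands [c k] to [r] and leaves unchanged what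
    happened before stage [k]. These are the possible outcomes of stage [k] given
    the past. *)
Section Swap.
Context (s : 'S_n) (k r : 'I_n) (kr : (k <= s r)%N).
Let s' := (s * tperm k (s r))%g.

Lemma swap_below i : (s i < k)%N -> s' i = s i.
Proof.
by move=> ik; rewrite permM tpermD // -(inj_eq val_inj) /=; lia.
Qed.

Lemma swap_above i : (k <= s i)%N -> (k <= s' i)%N.
Proof. by move=> ki; rewrite permM; case: tpermP => /=. Qed.

Lemma swap_leq l i : (l <= k)%N -> (l <= s' i)%N = (l <= s i)%N.
Proof.
move=> lk; case: (leqP k (s i)) => [ki|ik]; last by rewrite swap_below.
by rewrite (leq_trans lk ki) (leq_trans lk (swap_above ki)).
Qed.

Lemma swap_ltn (m : nat) i : (m <= k)%N -> (s' i < m)%N = (s i < m)%N.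
Proof.
move=> mk; case: (leqP k (s i)) => [ki|ik]; last by rewrite swap_below.
by have := swap_above ki; lia.
Qed.

Lemma swap_at : s' r = k.
Proof. by rewrite permM tpermR. Qed.

Lemma swapV_at : (s'^-1)%g k = r.
Proof. by rewrite -swap_at permK. Qed.

Lemma swapV_below l : (l < k)%N -> (s'^-1)%g l = (s^-1)%g l.
Proof.
move=> lk; apply: (@perm_inj _ s'); rewrite permKV swap_below permKV //.
Qed.

Lemma swap_at_risk l : (l <= k)%N -> at_risk s' l = at_risk s l.
Proof. by move=> lk; apply/setP => i; rewrite !inE swap_leq. Qed.

Lemma swap_km_factor l : (l < k)%N -> km_factor s' l = km_factor s l.
Proof.
by move=> lk; rewrite /km_factor swap_at_risk ?(ltnW lk) // swapV_below.
Qed.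

Lemma swap_km_before x : km_before s' k x = km_before s k x.
Proof. by apply: eq_bigr => l /andP[lk _]; exact: swap_km_factor. Qed.

Lemma swap_km_upto : km_upto s' k = km_upto s k.
Proof. by apply: eq_bigr => l; exact: swap_km_factor. Qed.

Lemma swap_ipc_weight i : ipc_weight s' k i = ipc_weight s k i.
Proof.
rewrite /ipc_weight swap_km_before swap_ltn //; congr ((~~ _)%:R / _).
by case: ltnP => //= ik; rewrite swap_below.
Qed.

End Swap.

Context (c_mono : forall k l, (k <= l)%N -> c k <= c l).

Lemma at_risk_km_before s k i : i \in at_risk s k -> km_before s k (t i) = km_upto s k.
Proof.
rewrite inE => /andP[_ ckt]; apply: eq_bigl => l.
by case: (ltnP l k) => //= lk; apply: le_lt_trans ckt; exact/c_mono/ltnW.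
Qed.

Lemma at_risk_weight s k i : i \in at_risk s k -> ipc_weight s k i = (km_upto s k)^-1.
Proof.
move=> iA; rewrite /ipc_weight at_risk_km_before //.
by move: iA; rewrite inE => /andP[ki _]; rewrite ltnNge ki /= mul1r.
Qed.

Section Step.
Context (s : 'S_n) (k r : 'I_n) (kr : (k <= s r)%N).
Let s' := (s * tperm k (s r))%g.

Lemma step_dead : r \notin at_risk s k ->
  km_upto s' k.+1 = km_upto s k /\ ipc_sum s' k.+1 = ipc_sum s k.
Proof.
rewrite inE kr /= => ckr.
have f1 : km_factor s' k = 1.
  by rewrite /km_factor swapV_at // (negbTE ckr) mul0r subr0.
split; first by rewrite km_uptoS f1 mulr1 swap_km_upto.
apply: eq_bigr => i _; congr (_ * _); rewrite -(swap_ipc_weight kr i).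
rewrite /ipc_weight km_beforeS f1 if_same mulr1; congr ((~~ _)%:R / _).
rewrite ltnS leq_eqVlt; case: eqP => //= /val_inj e; rewrite -/s' e ltnn /=.
have -> : i = r by apply: (@perm_inj _ s'); rewrite e swap_at.
by rewrite (negbTE ckr).
Qed.

Lemma step_weight_out i : i \notin at_risk s k ->
  ipc_weight s' k.+1 i = ipc_weight s k i.
Proof.
rewrite inE negb_and -ltnNge => iA; rewrite -(swap_ipc_weight kr i) -/s'.
rewrite /ipc_weight km_beforeS.
case: (boolP (c k < t i)) iA => [ckt|ckt _]; last first.
  rewrite mulr1; congr ((~~ _)%:R / _).
  rewrite ltnS leq_eqVlt; case: eqP => //= /val_inj e.
  by rewrite e (negbTE ckt) andbF.
rewrite orbF => ik; rewrite (swap_below kr ik) ltnS ik ltnW //=.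
by rewrite (le_lt_trans (c_mono (ltnW ik)) ckt) !mul0r.
Qed.

Lemma step_weight_in i : i \in at_risk s k ->
  ipc_weight s' k.+1 i = (i != r)%:R / km_upto s' k.+1.
Proof.
move=> iA; have := iA; rewrite inE => /andP[ki ckt].
rewrite /ipc_weight km_beforeS ckt at_risk_km_before ?swap_at_risk // -km_uptoS.
congr (_%:R / _).
have := swap_above kr ki; rewrite -/s' => ki'; rewrite ltnS leq_eqVlt (ltnNge (s' i)) ki' orbF.
case: (s' i =P k :> nat) => [/val_inj e|e] /=.
  rewrite e ckt; have -> : i = r by apply: (@perm_inj _ s'); rewrite e swap_at.
  by rewrite eqxx.
by case: eqP => // ir; case: e; rewrite ir /s' swap_at.
Qed.

Let N : R := #|at_risk s k|%:R.
Let G' : R := km_upto s k * (1 - N^-1).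

Lemma step_km : r \in at_risk s k -> km_upto s' k.+1 = G'.
Proof.
move=> rA; rewrite km_uptoS swap_km_upto // /km_factor swapV_at // swap_at_risk //.
by move: rA; rewrite inE => /andP[_ ->]; rewrite mul1r.
Qed.

(** Censoring [r] replaces the common weight [1 / G] of the at-risk individuals by
    [1 / G'], with [G' = G * (1 - 1 / N)], and drops the term of [r]. The change is
    proportional to the deviation of [a r] from its mean over the at-risk set, so it
    is centred when [r] is uniform in that set. *)
Lemma step_ipc_sum : r \in at_risk s k -> G' != 0 ->
  ipc_sum s' k.+1 - ipc_sum s k =
  G'^-1 * ((\sum_(i in at_risk s k) a i) / N - a r).
Proof.
move=> rA G'0.
have N0 : N != 0 by rewrite pnatr_eq0 -lt0n; apply/card_gt0P; exists r.
have [g0 N1] : km_upto s k != 0 /\ N - 1 != 0.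
  move: G'0; rewrite mulf_eq0 negb_or => /andP[-> h]; split => //.
  apply: contraNneq h => h; have -> : N = 1 by apply/eqP; rewrite -subr_eq0 h.
  by rewrite invr1 subrr.
rewrite /ipc_sum -sumrB (bigID (mem (at_risk s k))) /= [X in _ + X]big1 ?addr0; last first.
  by move=> i iA; rewrite step_weight_out // subrr.
under eq_bigr => i iA do
  rewrite step_weight_in // at_risk_weight // step_km // -mulrBr mulrC.
rewrite (bigD1 r) //= eqxx mul0r [in RHS](bigD1 r) //=.
under eq_bigr => i /andP[_ ->] do rewrite mulrC.
rewrite -mulr_suml /=.
move: (\sum_(i in _ | _) _) => y; rewrite /G'.
by field; rewrite N0 g0 N1.
Qed.

End Step.

Context (M : R) (aM : forall i, `|a i| <= M).

(** The indicator discards the paths on which the Kaplan-Meier product has reached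
    [0]. The product decreases, so its present value [g] is a lower bound at each of
    the [m] stages, and the accumulated variance is at most of order [m / g ^+ 2]. *)
Definition compensated (lam : R) s (m : nat) : R :=
  (0 < km_upto s m)%R%:R *
  expR (lam * (ipc_sum s m - \sum_i a i)
        - 4 * lam ^+ 2 * M ^+ 2 * m%:R / km_upto s m ^+ 2).

Lemma compensated_ge0 lam s m : 0 <= compensated lam s m.
Proof. by rewrite mulr_ge0 ?expR_ge0. Qed.

Lemma compensator_mono (lam g g' : R) (m m' : nat) :
  0 < g' <= g -> (m <= m')%N ->
  - (4 * lam ^+ 2 * M ^+ 2 * m'%:R / g' ^+ 2)
    <= - (4 * lam ^+ 2 * M ^+ 2 * m%:R / g ^+ 2).
Proof.
move=> /andP[g'0 g'g] mm'; have g0 := lt_le_trans g'0 g'g.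
have C0 : 0 <= 4 * lam ^+ 2 * M ^+ 2.
  by apply: mulr_ge0; [apply: mulr_ge0|]; rewrite ?sqr_ge0.
rewrite lerN2; apply: ler_pM.
- exact: mulr_ge0.
- by rewrite invr_ge0 sqr_ge0.
- by rewrite ler_wpM2l ?ler_nat.
- by rewrite lef_pV2 ?posrE ?exprn_gt0 // lerXn2r // nnegrE ltW.
Qed.

Lemma compensated_step_dead lam s k r : (k <= s r)%N -> r \notin at_risk s k ->
  compensated lam (s * tperm k (s r))%g k.+1 <= compensated lam s k.
Proof.
move=> kr rA; have [e1 e2] := step_dead kr rA.
rewrite /compensated e1 e2; case: ltP => [g0|_]; last by rewrite !mul0r.
by rewrite !mul1r ler_expR lerD2l compensator_mono ?g0 ?lexx.
Qed.

(** This is the Hoeffding step: the increments are centred and bounded by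
    [2 * `|lam| * M / G'], and the extra [4 * lam ^+ 2 * M ^+ 2 / G' ^+ 2] in the
    compensator absorbs their exponential moment. *)
Lemma compensated_step_hit lam s k :
  \sum_(r in at_risk s k) compensated lam (s * tperm k (s r))%g k.+1
    <= #|at_risk s k|%:R * compensated lam s k.
Proof.
set A := at_risk s k; set N : R := #|A|%:R.
pose g := km_upto s k; pose g' := g * (1 - N^-1).
have kA r : r \in A -> (k <= s r)%N by rewrite inE => /andP[].
(* g' vanishes if the last individual at risk is censored or the product was
   already 0; the indicator is then 0 *)
have [g'0|g'0] := ltP 0 g'; last first.
  rewrite big1 ?mulr_ge0 ?compensated_ge0 // => r rA.
  by rewrite /compensated step_km ?kA // ltNge -/g -/N -/g' g'0 mul0r.
have [g0 g1] : 0 <= g <= 1 /\ g' <= g.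
  split; first exact: km_upto_itv.
  by rewrite ler_piMr // ?gerBl ?invr_ge0 //; have /andP[] := km_upto_itv s k.
have gp : 0 < g by apply: lt_le_trans g'0 g1.
pose m := (\sum_(i in A) a i) / N.
pose y r := lam / g' * (m - a r).
pose E := lam * (ipc_sum s k - \sum_i a i)
  - 4 * lam ^+ 2 * M ^+ 2 * k.+1%:R / g' ^+ 2.
have hit r : r \in A ->
    compensated lam (s * tperm k (s r))%g k.+1 = expR E * expR (y r).
  move=> rA; rewrite /compensated step_km ?kA // -/g -/N -/g' g'0 mul1r -expRD.
  congr expR; rewrite /E /y.
  have := step_ipc_sum (kA _ rA) rA (lt0r_neq0 g'0).
  rewrite -/g -/N -/g' -/m => /eqP; rewrite subr_eq => /eqP ->.
  by ring.
rewrite (eq_bigr _ hit) -mulr_sumr.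
have [A0|A0] := posnP #|A|.
  by rewrite [X in _ * X]big1 ?mulr0 /N ?A0 ?mul0r // => i; rewrite (cards0_eq A0) inE.
have N0 : 0 < N by rewrite ltr0n.
have M0 : 0 <= M by have /card_gt0P[i _] := A0; exact: le_trans (aM i).
have mM : `|m| <= M.
  rewrite normrM normfV (gtr0_norm N0) ler_pdivrMr //.
  apply: le_trans (ler_norm_sum _ _ _) _.
  by rewrite mulr_natr -sumr_const; apply: ler_sum => i _.
have y0 : \sum_(i in A) y i = 0.
  rewrite -mulr_sumr sumrB sumr_const -mulr_natr /m divfK ?subrr ?mulr0 //.
  by rewrite gt_eqF.
have yB i : i \in A -> `|y i| <= 2 * `|lam| * M / g'.
  move=> _; rewrite normrM normrM normfV (gtr0_norm g'0).
  have -> : 2 * `|lam| * M / g' = `|lam| / g' * (M + M) by ring.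
  rewrite ler_wpM2l ?mulr_ge0 ?invr_ge0 ?(ltW g'0) //.
  by apply: le_trans (ler_normB _ _) _; rewrite lerD.
have := sum_expR_le_card y0 yB; rewrite -/N => le1.
apply: (le_trans (ler_wpM2l (expR_ge0 E) le1)).
rewrite mulrCA -expRD ler_wpM2l ?(ltW N0) // /compensated -/g gp mul1r ler_expR.
have -> : E + (2 * `|lam| * M / g') ^+ 2 = lam * (ipc_sum s k - \sum_i a i)
    - 4 * lam ^+ 2 * M ^+ 2 * k%:R / g' ^+ 2.
  have lam2 : `|lam| ^+ 2 = lam ^+ 2 by rewrite real_normK ?num_real.
  have -> : (2 * `|lam| * M / g') ^+ 2 = 4 * lam ^+ 2 * M ^+ 2 / g' ^+ 2.
    by rewrite -lam2; field; rewrite gt_eqF.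
  by rewrite /E -[k.+1%:R]natr1; ring.
by rewrite lerD2l compensator_mono ?g'0.
Qed.

Lemma compensated_step lam s k :
  \sum_(r | (k <= s r)%N) compensated lam (s * tperm k (s r))%g k.+1
    <= \sum_(r | (k <= s r)%N) compensated lam s k.
Proof.
rewrite (bigID (mem (at_risk s k))) [leRHS](bigID (mem (at_risk s k))) /=.
have AP r : (k <= s r)%N && (r \in at_risk s k) = (r \in at_risk s k).
  by rewrite inE; case: (k <= s r)%N.
rewrite lerD //; last first.
  by apply: ler_sum => r /andP[kr rA]; exact: compensated_step_dead.
rewrite !(eq_bigl _ _ AP) (le_trans (compensated_step_hit _ _ _)) //.
by rewrite sumr_const mulr_natl.
Qed.

(** Right multiplication by [tperm k j] permutes the group, so summing over [s] is the
    same as summing over [s] the average over [j >= k] of the value at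
    [s * tperm k j]. This is conditioning on the first [k] assignments. *)
Lemma compensated_mean_step lam k :
  \sum_s compensated lam s k.+1 <= \sum_s compensated lam s k.
Proof.
pose K := #|[pred j : 'I_n | (k <= j)%N]|.
have K0 : (0 < K)%N by apply/card_gt0P; exists k; rewrite inE.
have reix (F : 'S_n -> 'I_n -> R) s :
    \sum_(r | (k <= s r)%N) F s (s r) = \sum_(j : 'I_n | (k <= j)%N) F s j.
  by rewrite [RHS](reindex_inj (@perm_inj _ s)).
suff: K%:R * \sum_s compensated lam s k.+1 <= K%:R * \sum_s compensated lam s k.
  by rewrite ler_pM2l // ltr0n.
have -> : K%:R * \sum_s compensated lam s k.+1 =
    \sum_s \sum_(j : 'I_n | (k <= j)%N) compensated lam (s * tperm k j)%g k.+1.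
  rewrite exchange_big /= mulr_natl -sumr_const; apply: eq_bigr => j _.
  by rewrite (reindex_inj (mulIg (tperm k j))).
have -> : K%:R * \sum_s compensated lam s k =
    \sum_s \sum_(j : 'I_n | (k <= j)%N) compensated lam s k.
  by rewrite exchange_big /= mulr_natl -sumr_const.
apply: ler_sum => s _.
rewrite -(reix (fun s j => compensated lam (s * tperm k j)%g k.+1)).
rewrite -(reix (fun s j => compensated lam s k)).
exact: compensated_step.
Qed.

(** Iterating the previous step from stage [0], where the process is identically
    [1]. *)
Lemma sum_compensated_le_fact lam : \sum_s compensated lam s n <= (n`!)%:R.
Proof.
suff H m : (m <= n)%N -> \sum_s compensated lam s m <= (n`!)%:R by exact: H.
elim: m => [_|m IH mn]; last first.
  exact: le_trans (compensated_mean_step lam (Ordinal mn)) (IH (ltnW mn)).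
rewrite (eq_bigr (fun=> 1)) => [|s _].
  by rewrite sumr_const card_Sn.
rewrite /compensated; have g1 : km_upto s 0 = 1 by rewrite /km_upto big_pred0.
have -> : ipc_sum s 0 = \sum_i a i.
  apply: eq_bigr => i _; rewrite /ipc_weight /km_before big_pred0 //=.
  by rewrite invr1 !mulr1.
by rewrite g1 ltr01 subrr mulr0 mulr0 mul0r subr0 expR0 mulr1.
Qed.

End RandomAssignment.

(** * The Kaplan-Meier product of an assignment *)

Definition km_jump (R : realType) n (u : 'I_n -> R) (delta : 'I_n -> bool) (v : R) : R :=
  1 - #|[pred i | (u i == v) && ~~ delta i]|%:R / #|[pred i | v <= u i]|%:R.

(** The value just before [x] of the Kaplan-Meier step function; see
    [left_limit_kaplan_meier]. *)
Definition km_left (R : realType) n (u : 'I_n -> R) (delta : 'I_n -> bool) (x : R) : R :=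
  \prod_(v <- undup (codom u) | v < x) km_jump u delta v.

Lemma left_limit_kaplan_meier (R : realType) n (u : 'I_n -> R) (delta : 'I_n -> bool) (x : R) :
  left_limit (kaplan_meier_censoring u delta) x = km_left u delta x.
Proof.
rewrite /left_limit; apply: cvg_lim => //.
apply: (@cvg_trans _ (cst (km_left u delta x) @ x^'-)); last exact: cvg_cst.
apply: near_eq_cvg.
have H : \forall y \near x^'-, forall i, (u i <= y) = (u i < x).
  have K (r : seq 'I_n) : \forall y \near x^'-, forall i, i \in r -> (u i <= y) = (u i < x).
    elim: r => [|i r IH]; first by near=> y.
    have Hi : \forall y \near x^'-, (u i <= y) = (u i < x).
      case: (ltP (u i) x) => [ux|xu].
        by apply: filterS (nbhs_left_gt ux) => y /ltW.
      apply: filterS (nbhs_left_lt x) => y yx.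
      by apply/negbTE; rewrite -ltNge (lt_le_trans yx).
    apply: filterS2 Hi IH => y h IH j.
    by rewrite inE => /orP[/eqP ->|/IH].
  by apply: filterS (K (enum 'I_n)) => y h i; apply: h; rewrite mem_enum.
apply: filterS H => y H.
rewrite /cst /kaplan_meier_censoring /km_left.
rewrite big_seq_cond [RHS]big_seq_cond; apply: eq_bigl => v.
rewrite mem_undup; apply: andb_id2l => /codomP[i ->]; exact/esym/H.
Unshelve. all: by end_near. Qed.

Section KaplanMeierOfAssignment.
Context (R : realType) (n : nat) (t c : 'I_n -> R) (s : 'S_n).
Context (c_mono : forall k l : 'I_n, (k <= l)%N -> c k <= c l).
Context (no_tie : forall i j, t i != c j).

Let u i := Num.min (t i) (c (s i)).
Let delta i := t i <= c (s i).

(** Without ties between failure and censoring times, [i] is observed as censored at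
    [v] exactly when it receives the time [v] before failing. *)
Lemma censored_at i v : (u i == v) && ~~ delta i = (c (s i) == v) && (v < t i).
Proof.
rewrite /u /delta; have [tc|ct] := leP (t i) (c (s i)).
  rewrite andbF; apply/esym/negbTE; rewrite negb_and -leNgt.
  by case: eqP => //= <-.
by rewrite andbT; case: eqP => //= <-.
Qed.

(** The times equal to [v] are handed out one after the other, and each one that
    censors an individual lowers the number at risk by one. The factors
    [(N - 1) / N], [(N - 2) / (N - 1)], and so on, telescope to the single
    Kaplan-Meier factor at [v]. *)
Lemma prod_km_factor_block l0 (v := c l0) :
  \prod_(l < n | c l == v) km_factor t c s l = km_jump u delta v.
Proof.
pose D m := #|[set i : 'I_n | (s i < m)%N && ((c (s i) == v) && (v < t i))]%SET|.
pose N := #|[set i : 'I_n | (v <= c (s i)) && (v < t i)]%SET|.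
have -> : km_jump u delta v = 1 - (D n)%:R / N%:R.
  rewrite /km_jump; congr (1 - _%:R / _%:R).
    rewrite /D cardsE; apply: eq_card => i.
    by rewrite !inE [RHS]unfold_in ltn_ord /=; exact: censored_at.
  rewrite /N cardsE; apply: eq_card => i; rewrite !inE [RHS]unfold_in le_min andbC.
  by rewrite [v < t i]lt_neqAle eq_sym no_tie.
(* D m counts the individuals censored at v during the first m stages *)
suff H m : (m <= n)%N ->
    \prod_(l < n | (l < m)%N && (c l == v)) km_factor t c s l = 1 - (D m)%:R / N%:R.
  by rewrite -(H n (leqnn n)); apply: eq_bigl => l; rewrite ltn_ord.
elim: m => [_|m IH mn].
  rewrite big_pred0 // /D (_ : [set _ | _]%SET = finset.set0) ?cards0 ?mul0r ?subr0 //.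
pose k := Ordinal mn.
have DS : D m.+1 = (D m + ((c k == v) && (v < t ((s^-1)%g k)))%R)%N.
  rewrite /D (cardsD1 ((s^-1)%g k)) inE permKV /= ltnSn /= addnC; congr (_ + _)%N.
  apply: eq_card => i; rewrite !inE ltnS (leq_eqVlt (s i)).
  have -> : (i == (s^-1)%g k) = (s i == m :> nat).
    by rewrite -(inj_eq (@perm_inj _ s)) permKV -(inj_eq val_inj).
  case: eqP => [-> |] //=; by rewrite ltnn.
have [ckv|ckv] := eqVneq (c k) v; last first.
  rewrite DS (negbTE ckv) addn0 -IH ?(ltnW mn) //; apply: eq_bigl => l.
  rewrite ltnS leq_eqVlt; case: eqP => //= lk.
  have -> : l = k by exact: val_inj.
  by rewrite (negbTE ckv) andbF.
rewrite (bigD1 k) /= ?ltnSn ?ckv ?eqxx // mulrC.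
rewrite (eq_bigl (fun l : 'I_n => (l < m)%N && (c l == v))); last first.
  move=> l; rewrite ltnS -(inj_eq val_inj) /= (ltn_neqAle l m).
  by rewrite -andbA [(c l == v) && _]andbC andbCA andbA.
rewrite IH ?(ltnW mn) // DS ckv eqxx /= /km_factor ckv.
have NE : N = (#|at_risk t c s k| + D m)%N.
  rewrite /N /D -cardsUI (_ : at_risk _ _ _ _ :&: _ = finset.set0) ?cards0 ?addn0; last first.
    by apply/finset.setP => i; rewrite !inE /=; case: leqP; rewrite ?andbF.
  congr #|pred_of_set _|; apply/finset.setP => i; rewrite !inE ckv /=.
  case: (v < t i); rewrite ?andbF // !andbT.
  case: leqP => [mi|im] /=; first by rewrite -ckv; exact: c_mono.
  have h : c (s i) <= v by rewrite -ckv; apply: c_mono; exact: ltnW.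
  by rewrite eq_le h.
rewrite NE !natrD.
have [A0|A0] := posnP #|at_risk t c s k|.
  have /negbTE -> : ~~ (v < t ((s^-1)%g k)).
    by rewrite -ckv -at_risk_holder (cards0_eq A0) inE.
  by rewrite mul0r subr0 mulr1 addr0.
have p0 : #|at_risk t c s k|%:R + (D m)%:R != 0 :> R.
  by rewrite -natrD pnatr_eq0; lia.
have q0 : #|at_risk t c s k|%:R != 0 :> R by rewrite pnatr_eq0; lia.
by field; rewrite p0 q0.
Qed.

(** The factors with [c l < x] are grouped by the value of [c l]. A value that is not an
    observed time has only factors [1], and an observed time that is not a censoring
    time has no jump. *)
Lemma km_left_km_before x : km_left u delta x = km_before t c s n x.
Proof.
have J v :
    km_jump u delta v = \prod_(l < n | c l == v) km_factor t c s l.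
  have [[l /eqP <-]|h] := pselect (exists l, c l == v).
    by rewrite prod_km_factor_block.
  rewrite big_pred0 => [|l]; last by apply/negP => e; apply: h; exists l.
  rewrite /km_jump eq_card0 ?mul0r ?subr0 // => i; rewrite !inE censored_at.
  by apply/negP => /andP[e _]; apply: h; exists (s i).
rewrite /km_left (eq_bigr _ (fun v _ => J v)) big_mkcond /=.
rewrite (eq_bigr (fun v => \prod_(l < n)
    (if (v < x) && (c l == v) then km_factor t c s l else 1))) => [|v _]; last first.
  by case: (v < x) => /=; rewrite ?big1_eq // big_mkcond.
rewrite exchange_big /= /km_before [RHS]big_mkcond /=; apply: eq_bigr => l _.
rewrite ltn_ord /= -big_mkcond /=.
have [cu|cu] := boolP (c l \in codom u).
  rewrite big_mkcond (bigD1_seq (c l)) ?mem_undup ?undup_uniq //= eqxx andbT.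
  by rewrite big1 ?mulr1 // => v vc; rewrite eq_sym (negbTE vc) andbF.
rewrite big_seq_cond big_pred0 => [|v]; last first.
  rewrite mem_undup; apply/negP => /and3P[vu _ /eqP e].
  by rewrite e vu in cu.
case: ifP => // _; rewrite /km_factor; case: ltP => [ct|]; last by rewrite mul0r subr0.
move: cu => /negP[]; apply/codomP; exists ((s^-1)%g l); rewrite /u permKV.
by rewrite min_r // ltW.
Qed.

(** No one is at risk at a time [c l >= tau], so the factors from [tau] on are [1]. *)
Lemma km_left_km_upto tau : (forall i, t i <= tau) ->
  km_left u delta tau = km_upto t c s n.
Proof.
move=> tt; rewrite km_left_km_before /km_before /km_upto big_mkcond [RHS]big_mkcond.
apply: eq_bigr => l _; rewrite ltn_ord /=; case: ltP => // cl.
by rewrite /km_factor ltNge (le_trans (tt _) cl) mul0r subr0.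
Qed.

Lemma ipc_sum_km_left (a : 'I_n -> R) :
  \sum_i (delta i)%:R * a i / km_left u delta (t i) = ipc_sum t c a s n.
Proof.
apply: eq_bigr => i _; rewrite km_left_km_before /ipc_weight ltn_ord /= -leNgt.
by rewrite mulrA [_ * a i]mulrC.
Qed.

End KaplanMeierOfAssignment.

Lemma sorting_perm (R : realType) n (c : 'I_n -> R) :
  exists p : 'S_n, forall k l : 'I_n, (k <= l)%N -> c (p k) <= c (p l).
Proof.
have /tuple_permP[p Hp] : perm_eq (sort <=%O (mktuple c)) (mktuple c).
  by rewrite perm_sort.
exists p => k l kl.
have E (j : 'I_n) : nth 0 (sort <=%O (mktuple c)) j = c (p j).
  by rewrite Hp -tnth_nth !tnth_mktuple.
rewrite -!E; apply: (sorted_leq_nth le_trans le_refl) => //.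
- by apply: sort_sorted; exact: le_total.
- by rewrite inE size_sort size_tuple.
- by rewrite inE size_sort size_tuple.
Qed.

(** The final value of [compensated], in terms of the observed data. *)
Definition km_mgf (R : realType) n (lam M tau : R) (t a u : 'I_n -> R) (delta : 'I_n -> bool) : R :=
  (0 < km_left u delta tau)%R%:R *
  expR (lam * (\sum_i (delta i)%:R * a i / km_left u delta (t i) - \sum_i a i)
        - 4 * lam ^+ 2 * M ^+ 2 * n%:R / km_left u delta tau ^+ 2).

(** Given the failure times and the multiset of the censoring times, their assignment
    is a uniform permutation, and the sum over permutations does not depend on the
    order in which the times are listed; so [c] can be taken sorted. *)
Lemma km_mgf_mean (R : realType) n (lam M tau : R) (t a c : 'I_n -> R) :
  (forall i j, t i != c j) -> (forall i, t i <= tau) -> (forall i, `|a i| <= M) ->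
  \sum_(s : 'S_n) km_mgf lam M tau t a (fun i => Num.min (t i) (c (s i)))
                                       (fun i => t i <= c (s i)) <= (n`!)%:R.
Proof.
move=> tc tt aM; have [p pm] := sorting_perm c.
rewrite (reindex_inj (mulIg p)) /=.
have := sum_compensated_le_fact t (c := c \o p) pm aM lam; apply: le_trans.
rewrite le_eqVlt; apply/orP; left; apply/eqP; apply: eq_bigr => s _.
have tcp i j : t i != (c \o p) j by rewrite tc.
have E (i : 'I_n) : c ((s * p)%g i) = (c \o p) (s i) by rewrite permM.
have -> : (fun i => Num.min (t i) (c ((s * p)%g i))) =
          (fun i => Num.min (t i) ((c \o p) (s i))).
  by apply/funext => i; rewrite E.
have -> : (fun i => t i <= c ((s * p)%g i)) = (fun i => t i <= (c \o p) (s i)).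
  by apply/funext => i; rewrite E.
by rewrite /km_mgf /compensated (km_left_km_upto s pm tcp tt) (ipc_sum_km_left s pm tcp).
Qed.

(** * Products of a probability measure *)

Lemma pushforward_probability d1 d2 (X : measurableType d1) (Y : measurableType d2)
    (R : realType) (P : probability X R) (f : X -> Y) :
  measurable_fun setT f ->
  exists Q : probability Y R, (forall A, Q A = P (f @^-1` A)) /\
    forall (g : Y -> R) (M : R), measurable_fun setT g -> (forall y, `|g y| <= M) ->
      (\int[Q]_y (g y)%:E = \int[P]_x (g (f x))%:E)%E.
Proof.
move=> mf; pose F : {mfun X >-> Y} := HB.pack f (isMeasurableFun.Build _ _ _ _ _ mf).
exists (distribution P F); split=> // g M mg gM.
rewrite /distribution integral_pushforward ?preimage_setT //.
  exact/measurable_EFinP.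
apply: (measurable_bounded_integrable (f := g \o f)) => //.
- by apply: le_lt_trans (probability_le1 P _) _; rewrite ?ltry.
- exact: measurableT_comp.
- by exists M; split; [exact: num_real|move=> M' /ltW MM' x _; exact: le_trans (gM _) MM'].
Qed.

Definition cylinder (X : Type) n (A : 'I_n -> set X) : set (n.-tuple X) :=
  [set x | forall i, A i (tnth x i)].

Lemma measurable_cylinder d (X : measurableType d) n (A : 'I_n -> set X) :
  (forall i, measurable (A i)) -> measurable (cylinder A).
Proof.
move=> mA.
have -> : cylinder A = \bigcap_(i in [set: 'I_n]) ((@tnth n X ^~ i) @^-1` A i).
  by apply/seteqP; split=> x H i; [move=> _; exact: H|exact: (H i I)].
apply: fin_bigcap_measurable => // i _; rewrite -[X in measurable X]setTI.
exact: measurable_tnth.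
Qed.

(** Cylinders with sides in a generating pi-system form a pi-system generating the
    sigma-algebra of [n.-tuple X]. *)
Lemma eq_probability_on_cylinders d (X : measurableType d) (R : realType) n
    (G : set (set X)) (mu nu : probability (n.-tuple X) R) :
  setI_closed G -> G setT -> @measurable d X = <<s G >> ->
  (forall A : 'I_n -> set X, (forall i, G (A i)) -> mu (cylinder A) = nu (cylinder A)) ->
  forall B, measurable B -> mu B = nu B.
Proof.
move=> GI GT mG mn B mB.
pose C : set (set (n.-tuple X)) := [set cylinder A | A in [set A | forall i, G (A i)]].
have Gm A : G A -> measurable A by rewrite mG; exact: sub_sigma_algebra.
have CT : C setT.
  by exists (fun=> setT) => //=; apply/seteqP; split.
apply: (@measure_unique _ R _ C (fun=> setT) _ _ _ _ mu nu) => //.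
- apply/seteqP; split; last first.
    apply: smallest_sub; first exact: sigma_algebra_measurable.
    by move=> _ [A GA <-]; apply: measurable_cylinder => i; exact/Gm/GA.
  apply: smallest_sub; first exact: smallest_sigma_algebra.
  rewrite -bigcup_seq => D [i _] [E mE <-]; rewrite setTI.
  pose H := image_set_system setT (@tnth n X ^~ i) <<s C >>.
  suff GH : <<s G >> `<=` H by have := GH E; rewrite -mG => /(_ mE); rewrite /H /image_set_system /= setTI.
  apply: smallest_sub; first exact: sigma_algebra_image.
  move=> A GA; rewrite /H /image_set_system /= setTI; apply: sub_sigma_algebra.
  exists (fun j => if j == i then A else setT) => [j /=|]; first by case: ifP.
  apply/seteqP; split=> x /= => [/(_ i)|Ax j]; first by rewrite eqxx.
  by case: eqP => [->|].
- move=> _ _ [A GA <-] [A' GA' <-]; exists (fun i => A i `&` A' i).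
    by move=> i; exact: GI.
  by apply/seteqP; split=> x /= => [H|[H H'] i]; split => // i; have [] := H i.
- by rewrite bigcup_const.
- by move=> _ [A GA <-]; exact: mn.
- by move=> _; apply: le_lt_trans (probability_le1 mu _) _; rewrite ?ltry.
Qed.

(** [Qn] is the [n]-fold product of [Q], characterized by the integrals of products of
    functions of one coordinate; this form contains both the law of cylinders and
    the factorization of exponential moments. *)
Definition iid_power d (X : measurableType d) (R : realType) (Q : probability X R) n
    (Qn : probability (n.-tuple X) R) : Prop :=
  forall g : 'I_n -> X -> R,
    (forall i, measurable_fun setT (g i)) -> (forall i x, 0 <= g i x) ->
    (\int[Qn]_x (\prod_i g i (tnth x i))%:E = \prod_i \int[Q]_x (g i x)%:E)%E.

(** By induction on [n]: the image of [Q \x Qn] by [cons], with Tonelli's theorem. *)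
Lemma iid_power_exists d (X : measurableType d) (R : realType) (Q : probability X R) n :
  exists Qn : probability (n.-tuple X) R, iid_power Q Qn.
Proof.
elim: n => [|n [Qn IH]].
  exists (dirac [tuple]) => g mg g0; rewrite integral_dirac //.
    by rewrite !big_ord0 diracT mul1e.
  by under eq_fun do rewrite big_ord0; exact: measurable_cst.
pose cn (xy : X * n.-tuple X) := [the n.+1.-tuple X of xy.1 :: xy.2].
have mcn : measurable_fun setT cn.
  by apply: measurable_cons; [exact: measurable_fst|exact: measurable_snd].
pose F : {mfun _ >-> _} := HB.pack cn (isMeasurableFun.Build _ _ _ _ _ mcn).
exists (distribution (Q \x Qn)%E F) => g mg g0.
have mp m (h : 'I_m -> X -> R) : (forall i, measurable_fun setT (h i)) ->
    measurable_fun setT (EFin \o (fun x : m.-tuple X => \prod_i h i (tnth x i))).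
  move=> mh; apply/measurable_EFinP; apply: measurable_prod => i _.
  by apply: measurableT_comp => //; exact: measurable_tnth.
have h0 (m : nat) (h : 'I_m -> X -> R) (x : m.-tuple X) : (forall i x, 0 <= h i x) ->
    (0 <= (\prod_i h i (tnth x i))%:E)%E.
  by move=> h0; rewrite lee_fin; apply: prodr_ge0.
rewrite /distribution ge0_integral_pushforward //; last 2 first.
- exact: mp.
- by move=> x _; exact: h0.
rewrite preimage_setT /= fubini_tonelli1 /=; last 2 first.
- exact: (measurableT_comp (mp _ _ mg) mcn).
- by move=> x; exact: h0.
rewrite big_ord_recl -(IH (fun i => g (lift ord0 i))) //.
rewrite -ge0_integralZr //; last 3 first.
- exact/measurable_EFinP.
- by move=> x _; rewrite lee_fin.
- by apply: integral_ge0 => x _; exact: (h0 _ (fun i => g (lift ord0 i))).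
apply: eq_integral => x _; rewrite /fubini_F /= -ge0_integralZl_EFin //; last 2 first.
- by move=> y _; exact: (h0 _ (fun i => g (lift ord0 i))).
- exact: (mp _ (fun i => g (lift ord0 i))).
apply: eq_integral => y _; rewrite big_ord_recl EFinM tnth0; congr (_ * _%:E)%E.
by apply: eq_bigr => i _; rewrite tnthS.
Qed.

(** The formula [x^-1 = x * (x ^+ 2) `^ (-1)] holds at [0] too, and reduces the claim
    to powers of nonnegative reals. *)
Lemma measurable_fun_invr d (X : measurableType d) (R : realType) (f : X -> R) :
  measurable_fun setT f -> measurable_fun setT (fun x => (f x)^-1).
Proof.
move=> mf.
have -> : (fun x => (f x)^-1) = (fun x => f x * ((f x) ^+ 2) `^ (-1)).
  apply/funext => x; rewrite powR_inv1 ?sqr_ge0 //.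
  have [->|fx] := eqVneq (f x) 0; first by rewrite invr0 mul0r.
  by rewrite expr2 invfM mulrA mulfV // mul1r.
apply: measurable_funM => //.
apply: (@measurableT_comp _ _ _ _ _ _ (fun y : R => y `^ (-1))).
  exact: measurable_powR.
exact: measurable_funX.
Qed.

Lemma iid_power_cylinder d (X : measurableType d) (R : realType) (Q : probability X R) n
    (Qn : probability (n.-tuple X) R) (A : 'I_n -> set X) :
  iid_power Q Qn -> (forall i, measurable (A i)) ->
  Qn (cylinder A) = (\prod_i Q (A i))%E.
Proof.
move=> iid mA; have := iid (fun i => \1_(A i)).
have -> : (\prod_i (\int[Q]_x (\1_(A i) x)%:E) = \prod_i Q (A i))%E.
  by apply: eq_bigr => i _; rewrite integral_indic // setIT.
move=> <-; last 2 first.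
- by move=> i; exact: measurable_indic.
- by move=> i x; rewrite indicE.
rewrite -[LHS]/(Qn (cylinder A)) -[cylinder A]setIT -integral_indic //; last first.
  exact: measurable_cylinder.
apply: eq_integral => x _; congr (_%:E); rewrite indicE.
have [/set_mem cA|cA] := boolP (x \in cylinder A).
  by rewrite big1 // => i _; rewrite indicE mem_set.
have [i /negP Ai] : exists i, ~~ (tnth x i \in A i).
  apply: contrapT => h; move/negP: cA; apply; apply/mem_set => i; apply: contrapT => Ai.
  by apply: h; exists i; apply/negP => /set_mem.
by rewrite (bigD1 i) //= indicE; move/negP/negbTE: Ai => ->; rewrite mul0r.
Qed.

(** Independent copies of an observation have the law of the image by [phi] of
    independent copies of a sample that [phi] maps to such an observation. This
    replaces the given data, of which only the observable part is known to be
    i.i.d., by complete data. *)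
Lemma iid_copies_law d (Omega : measurableType d) (R : realType) (P : probability Omega R)
    d1 (Y : measurableType d1) (Q : probability Y R) d2 (E : measurableType d2) n
    (Qn : probability (n.-tuple Y) R) (X : 'I_n -> Omega -> E) (X0 : Omega -> E) (phi : Y -> E) :
  iid_power Q Qn -> iid_copies P X X0 ->
  (forall i, measurable_fun setT (X i)) -> measurable_fun setT phi ->
  (forall A, measurable A -> P (X0 @^-1` A) = Q (phi @^-1` A)) ->
  forall B, measurable B ->
    P ((fun w => [tuple X i w | i < n]) @^-1` B) =
    Qn ((fun y => [tuple phi (tnth y i) | i < n]) @^-1` B).
Proof.
move=> iid [ind same] mX mphi lawX B mB.
have mt dd (W : measurableType dd) (g : 'I_n -> W -> E) : (forall i, measurable_fun setT (g i)) ->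
    measurable_fun setT (fun w => [tuple g i w | i < n]).
  move=> mg; apply/measurable_fun_tnthP => i; rewrite (_ : _ \o _ = g i) //.
  by apply/funext => w /=; rewrite tnth_mktuple.
have [mu [muE _]] := pushforward_probability P (mt _ _ _ mX).
have mphin : measurable_fun setT (fun y : n.-tuple Y => [tuple phi (tnth y i) | i < n]).
  by apply: mt => i; apply: measurableT_comp => //; exact: measurable_tnth.
have [nu [nuE _]] := pushforward_probability Qn mphin.
rewrite -muE -nuE; apply: (@eq_probability_on_cylinders _ _ _ _ measurable) => //.
- by move=> ? ?; exact: measurableI.
- by rewrite sigma_algebra_id //; exact: sigma_algebra_measurable.
move=> A mA; rewrite muE nuE.
have -> : (fun w => [tuple X i w | i < n]) @^-1` cylinder A =
    \bigcap_(i in [set i | i \in [set: 'I_n]%SET]) (X i @^-1` A i).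
  apply/seteqP; split=> w /= H i; first by move=> _; have := H i; rewrite tnth_mktuple.
  by rewrite tnth_mktuple; apply: H; exact: finset.in_setT.
have -> : (fun y : n.-tuple Y => [tuple phi (tnth y i) | i < n]) @^-1` cylinder A =
    cylinder (fun i => phi @^-1` A i).
  by apply/seteqP; split=> w /= H i; have := H i; rewrite tnth_mktuple.
rewrite ind // (iid_power_cylinder iid); last first.
  by move=> i; rewrite -[X in measurable X]setTI; exact: mphi.
rewrite big_set /=; apply: eq_bigr => i _.
by rewrite (same i) // lawX.
Qed.

Definition permute_snd (E F : Type) n (s : 'S_n) (x : n.-tuple (E * F)) : n.-tuple (E * F) :=
  [tuple ((tnth x i).1, (tnth x (s i)).2) | i < n].

Lemma measurable_permute_snd d1 d2 (E : measurableType d1) (F : measurableType d2) n (s : 'S_n) :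
  measurable_fun setT (@permute_snd E F n s).
Proof.
apply/measurable_fun_tnthP => i.
rewrite (_ : _ \o _ = fun x => ((tnth x i).1, (tnth x (s i)).2)); last first.
  by apply/funext => x /=; rewrite tnth_mktuple.
by apply: measurable_fun_pair; apply: measurableT_comp => //; exact: measurable_tnth.
Qed.

(** Exchangeability: both sides factor on a product of rectangles, and permuting the
    second components only reorders one of the products. *)
Lemma iid_power_permute_snd d1 d2 (E : measurableType d1) (F : measurableType d2)
    (R : realType) (Q : probability (E * F)%type R) n (Qn : probability (n.-tuple (E * F)) R) (s : 'S_n) :
  iid_power Q Qn ->
  (forall A B, measurable A -> measurable B ->
     Q (A `*` B) = (Q (A `*` setT) * Q (setT `*` B))%E) ->
  forall D, measurable D -> Qn (permute_snd s @^-1` D) = Qn D.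
Proof.
move=> iid indep D mD.
have [mu [muE _]] := pushforward_probability Qn (@measurable_permute_snd _ _ E F n s).
rewrite -muE; pose G := [set A `*` B | A in @measurable _ E & B in @measurable _ F].
apply: (@eq_probability_on_cylinders _ _ _ _ G) => //.
- move=> _ _ [A mA [B mB <-]] [A' mA' [B' mB' <-]].
  exists (A `&` A'); first exact: measurableI.
  by exists (B `&` B'); [exact: measurableI|rewrite setXI].
- by exists setT => //; exists setT => //; rewrite setXTT.
- exact: measurable_prod_measurableType.
move=> C GC; rewrite muE.
have /choice[AB ABE] i : exists AB : set E * set F,
    [/\ measurable AB.1, measurable AB.2 & C i = AB.1 `*` AB.2].
  by have [A mA [B mB <-]] := GC i; exists (A, B).
pose A i := (AB i).1; pose B i := (AB i).2.
have mA i : measurable (A i) by have [] := ABE i.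
have mB i : measurable (B i) by have [] := ABE i.
have -> : C = fun i => A i `*` B i by apply/funext => i; have [] := ABE i.
have -> : permute_snd s @^-1` cylinder (fun i => A i `*` B i) =
    cylinder (fun i => A i `*` B ((s^-1)%g i)).
  apply/seteqP; split=> x /= H i.
    have [h _] := H i; have [_ h'] := H ((s^-1)%g i); move: h h'.
    by rewrite !tnth_mktuple /= permKV.
  have [h _] := H i; have [_] := H (s i); rewrite permK tnth_mktuple => h'.
  by split.
rewrite !(iid_power_cylinder iid); try by move=> i; exact: measurableX.
have split_prod (B' : 'I_n -> set F) : (forall i, measurable (B' i)) ->
    (\prod_i Q (A i `*` B' i) = (\prod_i Q (A i `*` setT)) * \prod_i Q (setT `*` B' i))%E.
  by move=> mB'; rewrite -big_split /=; apply: eq_bigr => i _; rewrite indep.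
rewrite split_prod // [RHS]split_prod //; congr (_ * _)%E.
by rewrite [RHS](reindex_inj (@perm_inj _ (s^-1)%g)).
Qed.

(** * Measurable extension and Hoeffding bound *)

(** [D] need not be measurable, so [f] itself cannot be integrated. For a rational
    [q], let [B q] be a measurable set with the same trace on [D] as [[set x | f x < q]];
    the infimum of the [q] with [x] in [B q], truncated to [[-M, M]], is [f x] on [D],
    and it is measurable because countably many [q] suffice. *)
Lemma measurable_on_extension d (X : measurableType d) (R : realType) (D : set X)
    (f : X -> R) (M : R) :
  measurable_on D f -> (forall x, D x -> `|f x| <= M) -> 0 <= M ->
  exists g : X -> R, [/\ measurable_fun setT g, forall x, `|g x| <= M &
    forall x, D x -> g x = f x].
Proof.
move=> mf fM M0.
pose q k : R := ratr (odflt 0 (unpickle k)).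
have /choice[B mB] k : exists B : set X, measurable B /\ D `&` f @^-1` `]-oo, q k[ = D `&` B.
  by have [B ? ?] := mf _ (measurable_itv `]-oo, q k[); exists B.
pose v k := Num.max (- M) (Num.min M (q k)).
have vM k : - M <= v k <= M.
  by rewrite le_max lexx /= ge_max ge_min lexx /= andbT; lra.
pose h k x : R := M - \1_(B k) x * (M - v k).
have hM k x : - M <= h k x <= M.
  by rewrite /h indicE; case: (x \in B k); have := vM k; rewrite ?mul1r ?mul0r; lra.
have lb x : has_lbound (range (h ^~ x)).
  by exists (- M) => _ [k _ <-]; have /andP[] := hM k x.
exists (fun x => infs (h ^~ x) 0); split.
- apply: measurable_fun_infs => [x _|k]; first exact: lb.
  apply: measurable_funB => //; apply: measurable_funM => //.
  by apply: measurable_indic; have [] := mB k.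
- move=> x; rewrite ler_norml; apply/andP; split.
    apply: lb_le_inf; first by exists (h 0 x); exists 0.
    by move=> _ [k _ <-]; have /andP[] := hM k x.
  have /andP[_] := hM 0 x; apply: le_trans; apply: ge_inf; last by exists 0.
  by apply/has_lbound_sdrop.
- move=> x Dx; have := fM _ Dx; rewrite ler_norml => /andP[fM1 fM2].
  have BE k : B k x <-> f x < q k.
    have [_ E] := mB k; split=> [Bx|fq].
      have : (D `&` B k) x by []. rewrite -E => -[_] /=; by rewrite in_itv.
    by have : (D `&` f @^-1` `]-oo, q k[) x; [split=> //=; rewrite in_itv|rewrite E => -[]].
  apply/le_anti/andP; split.
    apply/ler_addgt0Pr => e e0.
    have [r] : exists r, ratr r \in `]f x, f x + e[.
      by apply: rat_in_itvoo; rewrite ltrDl.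
    rewrite in_itv => /andP[fr re].
    pose k := pickle r; have qk : q k = ratr r by rewrite /q /k pickleK.
    apply: le_trans (ltW re); apply: (@le_trans _ _ (h k x)).
      by apply: ge_inf; [exact/has_lbound_sdrop|exists k].
    rewrite /h indicE mem_set; last by apply/BE; rewrite qk.
    rewrite mul1r subKr /v qk ge_max ge_min lexx orbT andbT.
    by rewrite (le_trans fM1) // ltW.
  apply: lb_le_inf; first by exists (h 0 x); exists 0.
  move=> _ [k _ <-]; rewrite /h indicE.
  have [/set_mem/BE fq|_] := boolP (x \in B k); last by rewrite mul0r subr0.
  by rewrite mul1r subKr /v le_max le_min fM2 (ltW fq) orbT.
Qed.

(** Hoeffding's lemma, with the constant given by [expR_le_id_add_expR_sqr]. *)
Lemma expR_centered_mean d (X : measurableType d) (R : realType)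
    (P : probability X R) (a : X -> R) (M lam : R) :
  0 <= M -> measurable_fun setT a -> (forall x, `|a x| <= M) ->
  (\int[P]_x (expR (lam * (a x - fine (\int[P]_y (a y)%:E)) - 4 * lam ^+ 2 * M ^+ 2))%:E
    <= 1)%E.
Proof.
move=> M0 ma aM; set m := fine _.
have ia : P.-integrable setT (EFin \o a).
  apply: measurable_bounded_integrable => //.
    by apply: le_lt_trans (probability_le1 P _) _; rewrite ?ltry.
  by exists M; split; [exact: num_real|move=> M' /ltW MM' x _; exact: le_trans (aM x) MM'].
have mE : (\int[P]_y (a y)%:E = m%:E)%E.
  by rewrite /m fineK //; exact: integrable_fin_num.
have mM : `|m| <= M.
  have : (`|m%:E| <= M%:E * P setT)%E.
    rewrite -mE; apply: le_trans (le_abse_integral _ _ _) _ => //.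
      exact/measurable_EFinP.
    apply: integral_le_bound => //; first exact/measurable_EFinP.
    by apply: aeW => x _; rewrite lee_fin.
  by rewrite probability_setT mule1 lee_fin.
pose C := expR (4 * lam ^+ 2 * M ^+ 2).
have yC x : expR (lam * (a x - m)) <= lam * a x + (C - lam * m).
  have -> : lam * a x + (C - lam * m) = lam * (a x - m) + C by ring.
  apply: le_trans (expR_le_id_add_expR_sqr _) _; rewrite lerD2l ler_expR.
  have -> : 4 * lam ^+ 2 * M ^+ 2 = lam ^+ 2 * (M + M) ^+ 2 by ring.
  rewrite exprMn ler_wpM2l ?sqr_ge0 // -[leLHS]real_normK ?num_real //.
  rewrite lerXn2r ?nnegrE ?addr_ge0 //.
  by apply: le_trans (ler_normB _ _) _; rewrite lerD.
have : (\int[P]_x (expR (lam * (a x - m)))%:E <= C%:E)%E.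
  apply: (@le_trans _ _ (\int[P]_x ((lam * a x)%:E + (C - lam * m)%:E))%E).
    apply: ge0_le_integral => //.
    - apply/measurable_EFinP; apply: measurableT_comp => //.
      by apply: measurable_funM => //; exact: measurable_funB.
    - apply/measurable_EFinP; apply: measurable_funD => //.
      exact: measurable_funM.
    - by move=> x _; rewrite -EFinD lee_fin.
  rewrite integralD_EFin //=; last 2 first.
  - exact: (integrableZl measurableT lam ia).
  - exact: finite_measure_integrable_cst.
  under eq_integral do rewrite EFinM.
  have -> : (\int[P]__ (C - lam * m)%:E = (C - lam * m)%:E)%E.
    by rewrite -[RHS]mule1 -(probability_setT P); exact: integral_cst.
  rewrite integralZl // mE.
  by rewrite -EFinM -EFinD lee_fin; lra.
move=> h; under eq_integral do rewrite expRD EFinM.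
rewrite ge0_integralZr //; last first.
  apply/measurable_EFinP; apply: measurableT_comp => //.
  by apply: measurable_funM => //; exact: measurable_funB.
rewrite expRN -/C.
apply: le_trans (lee_wpmul2r _ h) _; first by rewrite lee_fin invr_ge0 expR_ge0.
by rewrite -EFinM mulfV // gt_eqF ?expR_gt0.
Qed.

(** * Measurability and size of the estimators *)

(** The values of [u] are listed by their first occurrences. The product then runs over
    a fixed index set, which is what measurability in [u] requires. *)
Lemma prod_undup_codom (R : comPzRingType) (T : eqType) n (u : 'I_n -> T) (P : pred T) (F : T -> R) :
  \prod_(v <- undup (codom u) | P v) F v =
  \prod_(i < n | [forall j : 'I_n, (j < i)%N ==> (u j != u i)] && P (u i)) F (u i).
Proof.
pose first := [pred i : 'I_n | [forall j : 'I_n, (j < i)%N ==> (u j != u i)]].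
have E : perm_eq (undup (codom u)) [seq u i | i <- enum first].
  apply: uniq_perm; first exact: undup_uniq.
    rewrite map_inj_in_uniq ?enum_uniq // => i j.
    rewrite !mem_enum !inE => /forallP/= fi /forallP/= fj uij.
    apply/val_inj; case: (ltngtP i j) => // h.
      by have := implyP (fj i) h; rewrite uij eqxx.
    by have := implyP (fi j) h; rewrite uij eqxx.
  move=> v; rewrite mem_undup; apply/codomP/mapP => [[i ->]|[i _ ->]]; last by exists i.
  case: (@arg_minnP _ i (fun j => u j == u i) val (eqxx _)) => j /eqP uj jmin.
  exists j; last by rewrite uj.
  rewrite mem_enum inE; apply/forallP => l; apply/implyP => lj; apply/negP => /eqP ul.
  by have := jmin l; rewrite ul uj eqxx => /(_ isT); rewrite leqNgt lj.
by rewrite (perm_big _ E) /= big_map big_enum_cond.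
Qed.

Section Measurability.
Context d (W : measurableType d) (R : realType).

Lemma measurable_natr_bool (b : W -> bool) :
  measurable_fun setT b -> measurable_fun setT (fun w => (b w)%:R : R).
Proof.
move=> mb; rewrite (_ : (fun w => _) = fun w => if b w then 1 else 0).
  by apply: measurable_fun_ifT.
by apply/funext => w; case: (b w).
Qed.

Lemma measurable_forall n (b : 'I_n -> W -> bool) :
  (forall i, measurable_fun setT (b i)) -> measurable_fun setT (fun w => [forall i, b i w]).
Proof.
move=> mb; apply: (measurable_fun_bool true).
rewrite setTI (_ : _ @^-1` _ = \bigcap_(i in [set: 'I_n]) (b i @^-1` [set true])).
  apply: fin_bigcap_measurable => // i _; rewrite -[X in measurable X]setTI.
  exact: mb.
apply/seteqP; split=> w /=; first by move=> /forallP H i _; exact: H.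
by move=> H; apply/forallP => i; exact: H.
Qed.

Lemma measurable_card n (b : 'I_n -> W -> bool) :
  (forall i, measurable_fun setT (b i)) ->
  measurable_fun setT (fun w => #|[pred i | b i w]|%:R : R).
Proof.
move=> mb; rewrite (_ : (fun w => _) = fun w => \sum_i (b i w)%:R).
  by apply: measurable_sum => i; exact: measurable_natr_bool.
apply/funext => w; rewrite -sum1_card natr_sum big_mkcond /=; apply: eq_bigr => i _.
by rewrite inE; case: (b i w).
Qed.

Context n (u : 'I_n -> W -> R) (delta : 'I_n -> W -> bool).
Context (mu : forall i, measurable_fun setT (u i)).
Context (mdelta : forall i, measurable_fun setT (delta i)).

Lemma measurable_km_left (x : W -> R) : measurable_fun setT x ->
  measurable_fun setT (fun w => km_left (u^~ w) (delta^~ w) (x w)).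
Proof.
move=> mx; rewrite (_ : (fun w => _) = fun w => \prod_(i < n)
   if [forall j : 'I_n, (j < i)%N ==> (u j w != u i w)] && (u i w < x w)
   then km_jump (u^~ w) (delta^~ w) (u i w) else 1); last first.
  by apply/funext => w; rewrite /km_left prod_undup_codom big_mkcond.
apply: measurable_prod => i _; apply: measurable_fun_ifT => //.
  apply: measurable_and; last exact: measurable_fun_ltr.
  apply: measurable_forall => j; case: (j < i)%N => /=; last exact: measurable_cst.
  by apply: measurable_neg; exact: measurable_fun_eqr.
apply: measurable_funB => //; apply: measurable_funM.
  apply: measurable_card => j; apply: measurable_and; first exact: measurable_fun_eqr.
  exact: measurable_neg.
apply: measurable_fun_invr; apply: measurable_card => j; exact: measurable_fun_ler.
Qed.

Lemma measurable_at_risk_fraction (tau : R) :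
  measurable_fun setT (fun w => at_risk_fraction (u^~ w) tau).
Proof.
apply: measurable_funM => //; apply: measurable_card => i.
exact: measurable_fun_ler.
Qed.

End Measurability.

Lemma km_left_itv (R : realType) n (u : 'I_n -> R) (delta : 'I_n -> bool) x :
  0 <= km_left u delta x <= 1.
Proof.
apply: prod_itv01 => v _; rewrite /km_jump; set N := #|[pred i | v <= u i]|.
have [->|N0] := posnP N; first by rewrite invr0 mulr0 subr0 ler01 lexx.
rewrite subr_ge0 gerBl divr_ge0 // ler_pdivrMr ?ltr0n // mul1r ler_nat andbT.
by apply: subset_leq_card; apply/fintype.subsetP => i; rewrite !inE => /andP[/eqP ->].
Qed.

Lemma at_risk_fraction_itv (R : realType) n (u : 'I_n -> R) x :
  0 <= at_risk_fraction u x <= 1.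
Proof.
rewrite /at_risk_fraction mulr_ge0 ?invr_ge0 //=.
case: n u => [|n] u; first by rewrite invr0 mul0r.
rewrite mulrC ler_pdivrMr ?ltr0n // mul1r ler_nat.
by apply: leq_trans (max_card _) _; rewrite card_ord.
Qed.

(** With this [lam], [4 * lam ^+ 2 * M ^+ 2 * n%:R = eta / 2], and the assumed deviation
    gives [`|lam * (Y - n%:R * m)| >= 2 * eta / g ^+ 2] because [H <= 1]. As [g <= 1],
    the exponent of the term of the right sign is at least
    [2 * eta / g ^+ 2 - eta / (2 * g ^+ 2) - eta / 2 >= eta]: a deviation scaled by
    [g ^+ 2] pays for a variance of order [1 / g ^+ 2], and the same [lam] serves for
    every [g]. *)
Lemma deviation_bound (R : realType) (n : nat) (M eta H g Y S m : R) :
  (0 < n)%N -> 0 < M -> 0 < eta -> 0 <= H <= 1 -> 0 <= g <= 1 ->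
  let lam := Num.sqrt (2 * eta) / (4 * M * Num.sqrt n%:R) in
  4 * Num.sqrt (2 * eta) <= Num.sqrt n%:R * H * g ^+ 2 / M * `|n%:R^-1 * Y - m| ->
  expR eta <= \sum_(b : bool) (0 < g)%R%:R *
    expR ((-1) ^+ b * lam * (Y - S) - 4 * ((-1) ^+ b * lam) ^+ 2 * M ^+ 2 * n%:R / g ^+ 2) *
    expR ((-1) ^+ b * lam * (S - n%:R * m) - 4 * ((-1) ^+ b * lam) ^+ 2 * M ^+ 2 * n%:R).
Proof.
move=> n0 M0 eta0 /andP[H0 H1] /andP[g0 g1] lam hyp.
set q := Num.sqrt (2 * eta) in lam hyp *; set r := Num.sqrt n%:R in lam hyp *.
have q0 : 0 < q by rewrite sqrtr_gt0 mulr_gt0.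
have r0 : 0 < r by rewrite sqrtr_gt0 ltr0n.
have qq : q ^+ 2 = 2 * eta by rewrite sqr_sqrtr // mulr_ge0 // ltW.
have rr : n%:R = r ^+ 2 :> R by rewrite sqr_sqrtr // ler0n.
(* at g = 0 the scaled deviation is 0, below the threshold *)
have gp : 0 < g.
  rewrite lt_neqAle g0 andbT; apply/eqP => ge; move: hyp; rewrite -ge expr0n /= mulr0 !mul0r.
  by rewrite leNgt mulr_gt0.
have dev : 2 * eta / g ^+ 2 <= `|lam * (Y - n%:R * m)|.
  rewrite ler_pdivrMr ?exprn_gt0 // -qq.
  have -> : `|lam * (Y - n%:R * m)| * g ^+ 2 =
     q / 4 * (r * g ^+ 2 / M * `|n%:R^-1 * Y - m|).
    have -> : Y - n%:R * m = n%:R * (n%:R^-1 * Y - m).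
      by rewrite mulrBr mulrA mulfV ?mul1r // pnatr_eq0 -lt0n.
    have lam0 : 0 < lam by rewrite divr_gt0 // !mulr_gt0.
    rewrite normrM (gtr0_norm lam0) normrM [`|n%:R|]ger0_norm // {1}rr /lam.
    move: `|_| => x; field.
    by rewrite !gt_eqF.
  have le : 4 * q <= r * g ^+ 2 / M * `|n%:R^-1 * Y - m|.
    apply: le_trans hyp _; rewrite !ler_wpM2r ?invr_ge0 ?(ltW M0) ?sqr_ge0 //.
    by rewrite ler_piMr // ltW.
  apply: le_trans (ler_wpM2l _ le); last by rewrite divr_ge0 // ltW.
  by rewrite le_eqVlt; apply/orP; left; apply/eqP; field.
have C : 4 * lam ^+ 2 * M ^+ 2 * n%:R = eta / 2.
  rewrite rr /lam !expr_div_n; rewrite !exprMn qq; field.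
  by rewrite !gt_eqF.
have g2 : eta <= eta / g ^+ 2.
  by rewrite ler_pdivlMr ?exprn_gt0 // ler_piMr ?(ltW eta0) // exprn_ile1.
have key b : 2 * eta / g ^+ 2 <= (-1) ^+ b * lam * (Y - n%:R * m) ->
   expR eta <= (0 < g)%R%:R *
    expR ((-1) ^+ b * lam * (Y - S) - 4 * ((-1) ^+ b * lam) ^+ 2 * M ^+ 2 * n%:R / g ^+ 2) *
    expR ((-1) ^+ b * lam * (S - n%:R * m) - 4 * ((-1) ^+ b * lam) ^+ 2 * M ^+ 2 * n%:R).
  move=> h; rewrite gp mul1r -expRD ler_expR.
  have -> : ((-1) ^+ b * lam) ^+ 2 = lam ^+ 2 by rewrite exprMn sqrr_sign mul1r.
  rewrite C.
  have -> : (-1) ^+ b * lam * (Y - S) - eta / 2 / g ^+ 2 +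
    ((-1) ^+ b * lam * (S - n%:R * m) - eta / 2) =
    (-1) ^+ b * lam * (Y - n%:R * m) - (eta / g ^+ 2) / 2 - eta / 2.
    by field; rewrite gt_eqF.
  by move: h g2; rewrite -mulrA; move: (eta / g ^+ 2) => x; lra.
rewrite big_bool /=.
have nn b : 0 <= (0 < g)%R%:R *
    expR ((-1) ^+ b * lam * (Y - S) - 4 * ((-1) ^+ b * lam) ^+ 2 * M ^+ 2 * n%:R / g ^+ 2) *
    expR ((-1) ^+ b * lam * (S - n%:R * m) - 4 * ((-1) ^+ b * lam) ^+ 2 * M ^+ 2 * n%:R).
  by rewrite !mulr_ge0 ?expR_ge0.
move: dev; have [x0|x0] := lerP 0 (lam * (Y - n%:R * m)) => dev.
  apply: ler_wpDl; first exact: nn true.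
  by apply: (key false); rewrite expr0 mul1r -(ger0_norm x0).
apply: ler_wpDr; first exact: nn false.
by apply: (key true); rewrite expr1 mulN1r mulNr -(ltr0_norm x0).
Qed.

(** * The deviation probability *)

(** The event to be bounded, as a function of the observed times [u], the indicators
    [delta] and the values [b i] of the integrand at the observations. *)
Definition large_deviation (R : realType) n (tau M eta m : R) (u : 'I_n -> R)
    (delta : 'I_n -> bool) (b : 'I_n -> R) : bool :=
  4 * Num.sqrt (2 * eta) <=
  Num.sqrt n%:R * at_risk_fraction u tau * km_left u delta tau ^+ 2 / M
  * `|n%:R^-1 * (\sum_i (delta i)%:R * b i / km_left u delta (u i)) - m|.

Lemma measurable_large_deviation d (W : measurableType d) (R : realType) n
    (u b : 'I_n -> W -> R) (delta : 'I_n -> W -> bool) (tau M eta m : R) :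
  (forall i, measurable_fun setT (u i)) -> (forall i, measurable_fun setT (b i)) ->
  (forall i, measurable_fun setT (delta i)) ->
  measurable_fun setT (fun w => large_deviation tau M eta m (u^~ w) (delta^~ w) (b^~ w)).
Proof.
move=> mu mb mdelta; apply: measurable_fun_ler => //; apply: measurable_funM.
  apply: measurable_funM => //; apply: measurable_funM.
    by apply: measurable_funM => //; exact: measurable_at_risk_fraction.
  by apply: measurable_funX; exact: measurable_km_left.
apply: measurableT_comp => //; apply: measurable_funB => //; apply: measurable_funM => //.
apply: measurable_sum => i; apply: measurable_funM.
  by apply: measurable_funM => //; exact: measurable_natr_bool.
by apply: measurable_fun_invr; exact: measurable_km_left.
Qed.

(** Only the uncensored terms enter, so a censored observation can be given any value
    of the integrand. *)
Lemma eq_large_deviation (R : realType) n (tau M eta m : R) (u b b' : 'I_n -> R)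
    (delta : 'I_n -> bool) :
  (forall i, delta i -> b i = b' i) ->
  large_deviation tau M eta m u delta b = large_deviation tau M eta m u delta b'.
Proof.
move=> bb'; rewrite /large_deviation.
have -> : \sum_i (delta i)%:R * b i / km_left u delta (u i) =
          \sum_i (delta i)%:R * b' i / km_left u delta (u i) => //.
by apply: eq_bigr => i _; case E: (delta i); rewrite ?mul0r // bb'.
Qed.

(** The sign [(-1) ^+ b] selects one of the two tails. *)
Definition hoeffding_factor (R : realType) n (M eta : R) (b : bool) (y : R) : R :=
  let lam := (-1) ^+ b * (Num.sqrt (2 * eta) / (4 * M * Num.sqrt n%:R)) in
  expR (lam * y - 4 * lam ^+ 2 * M ^+ 2).

(** On the event, [expR eta] is at most a product of two factors, summed over the two
    tails. The sum over the permutations of the first factor is bounded by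
    [km_mgf_mean]; the second, for the fluctuation of the complete-data mean, does not
    depend on the permutation. *)
Lemma sum_large_deviation (R : realType) n (tau M eta m : R) (t a c : 'I_n -> R) :
  (0 < n)%N -> 0 < M -> 0 < eta -> (forall i j, t i != c j) ->
  (forall i, t i <= tau) -> (forall i, `|a i| <= M) ->
  \sum_(s : 'S_n) (large_deviation tau M eta m (fun i => Num.min (t i) (c (s i)))
     (fun i => t i <= c (s i)) a)%:R <=
  (n`!)%:R * expR (- eta) * \sum_(b : bool) \prod_i hoeffding_factor n M eta b (a i - m).
Proof.
move=> n0 M0 eta0 tc tt aM.
pose lam b : R := (-1) ^+ nat_of_bool b * (Num.sqrt (2 * eta) / (4 * M * Num.sqrt n%:R)).
pose K b := \prod_i hoeffding_factor n M eta b (a i - m).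
have KE b : K b = expR (lam b * (\sum_i a i - n%:R * m) - 4 * lam b ^+ 2 * M ^+ 2 * n%:R).
  rewrite /K /hoeffding_factor -expR_sum; congr expR.
  rewrite sumrB -mulr_sumr sumrB !sumr_const card_ord.
  by rewrite -(mulr_natr m) [m * _]mulrC -[(_ * _) *+ n]mulr_natr.
pose mgf b (s : 'S_n) := km_mgf (lam b) M tau t a (fun i => Num.min (t i) (c (s i)))
                                       (fun i => t i <= c (s i)).
apply: (@le_trans _ _ (\sum_(s : 'S_n) expR (- eta) * \sum_b mgf b s * K b)).
  apply: ler_sum => s _.
  have nn : 0 <= expR (- eta) * \sum_b mgf b s * K b.
    rewrite mulr_ge0 ?expR_ge0 // sumr_ge0 // => b _.
    by rewrite KE !mulr_ge0 ?expR_ge0.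
  case E: (large_deviation _ _ _ _ _ _ _) => //.
  set u := fun i => Num.min (t i) (c (s i)) in E *.
  set delta := fun i => t i <= c (s i) in E *.
  have uE : \sum_i (delta i)%:R * a i / km_left u delta (u i) =
            \sum_i (delta i)%:R * a i / km_left u delta (t i).
    apply: eq_bigr => i _; rewrite /u /delta.
    by case: leP => tci; rewrite ?mul0r.
  move: E; rewrite /large_deviation uE => /(deviation_bound (\sum_i a i) n0 M0 eta0
    (at_risk_fraction_itv _ _) (km_left_itv _ _ _)) H.
  rewrite expRN mulrC ler_pdivlMr ?expR_gt0 // mul1r (le_trans H) //.
  by apply: ler_sum => b _; rewrite KE.
rewrite -mulr_sumr exchange_big /= [leRHS]mulrAC mulrC ler_wpM2r ?expR_ge0 // mulr_sumr.
apply: ler_sum => b _; rewrite -mulr_suml ler_wpM2r //.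
  by rewrite KE expR_ge0.
exact: km_mgf_mean.
Qed.

Section CompleteData.
Context d (E : measurableType d) (R : realType) (Q : probability (E * R)%type R).
Context (n : nat) (Qn : probability (n.-tuple (E * R)) R).
Context (t a : E -> R) (tau M eta : R).
Context (iid : iid_power Q Qn).
Context (indep : forall A B, measurable A -> measurable B ->
     Q (A `*` B) = (Q (A `*` setT) * Q (setT `*` B))%E).
Context (mt : measurable_fun setT t) (ma : measurable_fun setT a).
Context (no_tie : Q [set x | t x.1 = x.2] = 0%E).
Context (t_tau : Q [set x | ~~ (t x.1 <= tau)] = 0%E).
Context (aM : forall e, `|a e| <= M).
Context (n0 : (0 < n)%N) (M0 : 0 < M) (eta0 : 0 < eta).

Let m := fine (\int[Q]_x (a x.1)%:E)%E.
Let ti i (x : n.-tuple (E * R)) := t (tnth x i).1.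
Let ai i (x : n.-tuple (E * R)) := a (tnth x i).1.
Let ci i (x : n.-tuple (E * R)) := (tnth x i).2.

Let deviation (x : n.-tuple (E * R)) :=
  large_deviation tau M eta m (fun i => Num.min (ti i x) (ci i x))
     (fun i => ti i x <= ci i x) (fun i => ai i x).

Let measurable_fst_tnth i : measurable_fun setT (fun x : n.-tuple (E * R) => (tnth x i).1).
Proof. by apply: measurableT_comp => //; exact: measurable_tnth. Qed.

Let mti i : measurable_fun setT (ti i).
Proof. exact: measurableT_comp. Qed.

Let mai i : measurable_fun setT (ai i).
Proof. exact: measurableT_comp. Qed.

Let mci i : measurable_fun setT (ci i).
Proof. by apply: measurableT_comp => //; exact: measurable_tnth. Qed.

Let mdeviation : measurable_fun setT deviation.
Proof.
apply: measurable_large_deviation => // i; last exact: measurable_fun_ler.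
exact: measurable_minr.
Qed.

(** A transposition of the censoring times pairs the failure time of [i] with the
    censoring time of [j], and a null event for a sample stays null. *)
Let perm_null (A : set (E * R)) i j : measurable A -> Q A = 0%E ->
  {ae Qn, forall x, ~ A ((tnth x i).1, (tnth x j).2)}.
Proof.
move=> mA A0.
pose C := cylinder (fun l : 'I_n => if l == i then A else setT).
have mC : measurable C by apply: measurable_cylinder => l; case: eqP.
exists (permute_snd (tperm i j) @^-1` C); split.
- by rewrite -[X in measurable X]setTI; exact: measurable_permute_snd.
- rewrite (iid_power_permute_snd _ iid indep) // (iid_power_cylinder iid).
    by rewrite (bigD1 i) //= eqxx A0 mul0e.
  by move=> l; case: eqP.
move=> x /= /contrapT Ax l; rewrite tnth_mktuple.
by case: (l =P i) => // ->; rewrite tpermL.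
Qed.

Let ae_regular : {ae Qn, forall x, (forall i j, ti i x != ci j x) /\ (forall i, ti i x <= tau)}.
Proof.
have m1 : measurable [set x : E * R | t x.1 = x.2].
  rewrite (_ : [set x | _] = (fun x : E * R => t x.1 == x.2) @^-1` [set true]).
    rewrite -[X in measurable X]setTI; apply: (@measurable_fun_eqr _ _ R setT) => //.
    exact: measurableT_comp.
  by apply/seteqP; split=> x /= /eqP.
have m2 : measurable [set x : E * R | ~~ (t x.1 <= tau)].
  rewrite -[X in measurable X]setTI.
  apply: (measurable_neg (measurable_fun_ler (measurableT_comp mt measurable_fst) (measurable_cst tau))) => //.
have A1 : {ae Qn, forall x, forall i j, ti i x != ci j x}.
  apply: filter_forall => i; apply: filter_forall => j.
  by apply: filterS (perm_null i j m1 no_tie) => x /= /eqP.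
have A2 : {ae Qn, forall x, forall i, ti i x <= tau}.
  apply: filter_forall => i.
  by apply: filterS (perm_null i i m2 t_tau) => x /= /negP; rewrite negbK.
by apply: filterS2 A1 A2 => x.
Qed.

Let mhoeffding b : measurable_fun setT (hoeffding_factor n M eta b).
Proof.
apply: measurableT_comp => //; apply: measurable_funB => //; exact: measurable_funM.
Qed.

Let hoeffding_mean b :
  (\int[Qn]_x (\prod_i hoeffding_factor n M eta b (ai i x - m))%:E <= 1)%E.
Proof.
rewrite (iid (g := fun _ y => hoeffding_factor n M eta b (a y.1 - m))); last 2 first.
- move=> i; apply: measurableT_comp => //; apply: measurable_funB => //.
  exact: measurableT_comp.
- by move=> i x; exact: expR_ge0.
have h1 : (\int[Q]_x (hoeffding_factor n M eta b (a x.1 - m))%:E <= 1)%E.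
  apply: expR_centered_mean; [exact: ltW| exact: measurableT_comp|by []].
suff /andP[] : (0 <= \prod_(i < n) \int[Q]_x (hoeffding_factor n M eta b (a x.1 - m))%:E <= 1)%E by [].
elim/big_ind: _ => [|x y /andP[x0 x1] /andP[y0 y1]|i _].
- by rewrite lee01 lexx.
- by rewrite mule_ge0 //= -[leRHS]mule1 lee_pmul.
- by rewrite h1 andbT; apply: integral_ge0 => x _; rewrite lee_fin expR_ge0.
Qed.

(** The law is invariant under permutations of the censoring times, so the probability
    is the mean over all of them, which [sum_large_deviation] bounds almost surely; the
    remaining factors have mean at most [1]. *)
Lemma deviation_probability : (Qn [set x | deviation x] <= (2 * expR (- eta))%:E)%E.
Proof.
pose F (s : 'S_n) x : R := (deviation (permute_snd s x))%:R.
have mF s : measurable_fun setT (F s).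
  apply: measurable_natr_bool; apply: measurableT_comp => //.
  exact: measurable_permute_snd.
have mD : measurable [set x | deviation x].
  by rewrite -[X in measurable X]setTI; exact: mdeviation.
have IF s : (\int[Qn]_x (F s x)%:E = Qn [set x | deviation x])%E.
  rewrite -(iid_power_permute_snd s iid indep mD) -[in RHS](setIT (_ @^-1` _)) -integral_indic //.
    apply: eq_integral => x _; rewrite /F indicE.
    have [h|h] := boolP (deviation _); first by rewrite mem_set.
    by rewrite memNset //=; apply/negP.
  by rewrite -[X in measurable X]setTI; exact: measurable_permute_snd.
pose K b x := \prod_i hoeffding_factor n M eta b (ai i x - m).
have mK b : measurable_fun setT (K b).
  apply: measurable_prod => i _; apply: measurableT_comp => //.
  exact: measurable_funB.
have K0 b x : 0 <= K b x by apply: prodr_ge0 => i _; exact: expR_ge0.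
pose c : R := (n`!)%:R * expR (- eta).
have c0 : 0 <= c by rewrite mulr_ge0 ?expR_ge0.
have : (\int[Qn]_x (\sum_s F s x)%:E <= \int[Qn]_x (c * \sum_b K b x)%:E)%E.
  apply: ae_ge0_le_integral => //.
  - by move=> x _; rewrite lee_fin sumr_ge0.
  - by apply/measurable_EFinP; exact: measurable_sum.
  - by move=> x _; rewrite lee_fin mulr_ge0 // sumr_ge0.
  - by apply/measurable_EFinP; apply: measurable_funM => //; exact: measurable_sum.
  apply: filterS ae_regular => x [tc tt] _; rewrite lee_fin.
  apply: le_trans (sum_large_deviation m n0 M0 eta0 tc tt (fun i => aM _)).
  apply: ler_sum => s _; rewrite /F /deviation le_eqVlt; apply/orP; left; apply/eqP.
  congr ((large_deviation _ _ _ _ _ _ _)%:R); apply/funext => i;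
    by rewrite /ti /ci /ai /permute_snd tnth_mktuple.
under eq_integral do rewrite -sumEFin.
rewrite ge0_integral_sum //; last 2 first.
- by move=> s; apply/measurable_EFinP; exact: mF.
- by move=> s x _; rewrite lee_fin.
rewrite (eq_bigr (fun=> Qn [set x | deviation x])) => [|s _]; last exact: IF.
have -> : Qn [set x | deviation x] = (fine (Qn [set x | deviation x]))%:E.
  by rewrite fineK // fin_num_measure.
set r := fine _ => lr.
have ub : (\int[Qn]_x (c * \sum_b K b x)%:E <= (c * 2)%:E)%E.
  under eq_integral do rewrite EFinM -sumEFin.
  rewrite ge0_integralZl_EFin //; last 2 first.
  - by move=> x _; apply: sume_ge0 => b _; rewrite lee_fin.
  - by apply: emeasurable_sum => b; exact/measurable_EFinP.
  rewrite [(c * 2)%:E]EFinM lee_wpmul2l ?lee_fin // ge0_integral_sum //; last 2 first.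
  - by move=> b; exact/measurable_EFinP.
  - by move=> b x _; rewrite lee_fin.
  rewrite big_bool (_ : 2%:E = 1 + 1)%E; last by rewrite -EFinD.
  by apply: leeD; exact: hoeffding_mean.
move: (le_trans lr ub); rewrite sumEFin !lee_fin sumr_const card_Sn -[r *+ _]mulr_natl /c.
by rewrite -mulrA ler_pM2l ?ltr0n ?fact_gt0 // mulrC.
Qed.
End CompleteData.

Theorem theorem5 (R : realType) :
  exists Do : R,
  forall (tau : R) (k : nat) (Zset : set (k.-tuple R))
    (d : measure_display) (Omega : measurableType d) (P : probability Omega R)
    (T C : {RV P >-> R}) (Z : {RV P >-> k.-tuple R}),
  0 < tau ->
  (forall w, Zset (Z w)) ->
  (forall w, 0 <= C w) ->
  independent_RVs P (fun w => (T w, Z w)) C ->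
  (forall w, 0 <= T w <= tau) ->
  (0 < P [set w | (tau <= observed_time T C w)%R])%E ->
  P [set w | T w = C w] = 0%E ->
  forall (f : R * k.-tuple R -> R) (M : R),
  0 < M ->
  measurable_on (`[0, tau] `*` Zset) f ->
  (forall t z, 0 <= t <= tau -> Zset z -> `|f (t, z)| <= M) ->
  forall (n : nat) (Ts Cs : 'I_n -> {RV P >-> R})
    (Zs : 'I_n -> {RV P >-> k.-tuple R}),
  (0 < n)%N ->
  (forall i w, 0 <= Ts i w <= tau) ->
  (forall i w, 0 <= Cs i w) ->
  (forall i w, Zset (Zs i w)) ->
  iid_copies P (fun i => observation (Ts i) (Cs i) (Zs i))
               (observation T C Z) ->
  forall eta : R, 0 < eta ->
  let U w := fun i : 'I_n => observed_time (Ts i) (Cs i) w in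
  let delta w := fun i : 'I_n => uncensored (Ts i) (Cs i) w in
  let H_tau w := at_risk_fraction (U w) tau in
  let G_tau w := left_limit (kaplan_meier_censoring (U w) (delta w)) tau in
  let muhat w :=
    mu_hat (fun i => Ts i w) (U w) (delta w) (fun i => Zs i w) f in
  let mu := fine 'E_P[fun w => f (T w, Z w)]%E in
  (P [set w | (4 * Num.sqrt (2 * eta) + 3 * Do <=
               Num.sqrt n%:R * H_tau w * G_tau w ^+ 2 / M
                 * `|muhat w - mu|)%R]
   <= (11 / 2 * expR (- eta))%:E)%E.
Proof.
(* the two exponential moments alone give the bound 2 * expR (- eta) at the
   threshold 4 * Num.sqrt (2 * eta), so the additive constant can be 0 *)
exists 0 => tau k Zset d Omega P T C Z tau0 ZZ C0 indep T_tau _ TC f M M0 mf fM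
  n Ts Cs Zs n0 Ts_tau Cs0 ZsZ iid eta eta0.
pose U w := fun i : 'I_n => observed_time (Ts i) (Cs i) w.
pose delta w := fun i : 'I_n => uncensored (Ts i) (Cs i) w.
pose H_tau w := at_risk_fraction (U w) tau.
pose G_tau w := left_limit (kaplan_meier_censoring (U w) (delta w)) tau.
pose muhat w :=
  mu_hat (fun i => Ts i w) (U w) (delta w) (fun i => Zs i w) f.
pose mu := fine 'E_P[fun w => f (T w, Z w)]%E.
change (P [set w | (4 * Num.sqrt (2 * eta) + 3 * 0 <=
  Num.sqrt n%:R * H_tau w * G_tau w ^+ 2 / M * `|muhat w - mu|)%R]
  <= (11 / 2 * expR (- eta))%:E)%E.
rewrite mulr0 addr0.
have [a [ma aM aE]] : exists a : R * k.-tuple R -> R, [/\ measurable_fun setT a,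
    forall e, `|a e| <= M & forall e, (`[0, tau] `*` Zset) e -> a e = f e].
  apply: (measurable_on_extension mf) => [[t z] [/= tt Zz]|]; last exact: ltW.
  by apply: fM => //; move: tt; rewrite in_itv.
pose E : measurableType _ := (R * k.-tuple R)%type.
(* complete data: the censoring time is kept beside the pair (T, Z) *)
pose sample w : E * R := ((T w, Z w), C w).
have msample : measurable_fun setT sample.
  by apply: measurable_fun_pair => //; exact: measurable_fun_pair.
have [Q [QE Qint]] := pushforward_probability P msample.
have [Qn Qn_iid] := iid_power_exists Q n.
pose obs (x : E * R) : R * bool * k.-tuple R := (Num.min x.1.1 x.2, x.1.1 <= x.2, x.1.2).
have mobs : measurable_fun setT obs.
  have m11 : measurable_fun setT (fun x : E * R => x.1.1).
    exact: (measurableT_comp measurable_fst measurable_fst).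
  have m12 : measurable_fun setT (fun x : E * R => x.1.2).
    exact: (measurableT_comp measurable_snd measurable_fst).
  apply: measurable_fun_pair => //; apply: measurable_fun_pair.
    exact: measurable_minr.
  exact: measurable_fun_ler.
have mobservation i : measurable_fun setT (observation (Ts i) (Cs i) (Zs i)).
  apply: measurable_fun_pair => //; apply: measurable_fun_pair.
    exact: measurable_minr.
  exact: measurable_fun_ler.
have Q_indep A B : measurable A -> measurable B ->
    Q (A `*` B) = (Q (A `*` setT) * Q (setT `*` B))%E.
  move=> mA mB; rewrite !QE.
  have -> : sample @^-1` (A `*` B) = (fun w => (T w, Z w)) @^-1` A `&` C @^-1` B by [].
  rewrite indep //; congr (P _ * P _)%E.
    by apply/seteqP; split=> w //= [].
  by apply/seteqP; split=> w //= [].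
have Q_no_tie : Q [set x | x.1.1 = x.2] = 0%E by rewrite QE.
have Q_tau : Q [set x | ~~ (x.1.1 <= tau)] = 0%E.
  rewrite QE (_ : _ @^-1` _ = set0) ?measure0 //.
  by apply/seteqP; split=> w //=; have /andP[_ ->] := T_tau w.
have muE : mu = fine (\int[Q]_x (a x.1)%:E)%E.
  rewrite (Qint (a \o fst) M (measurableT_comp ma measurable_fst) (fun x => aM x.1)).
  rewrite /mu unlock; congr fine; apply: eq_integral => w _.
  by rewrite /= aE //; split=> /=; rewrite ?in_itv /= ?T_tau.
(* the data show a at (u, z), the complete data at (t, z); they differ only at
   censored observations, see eq_large_deviation *)
pose B := [set o : n.-tuple (R * bool * k.-tuple R) |
  large_deviation tau M eta mu (fun i => (tnth o i).1.1) (fun i => (tnth o i).1.2)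
    (fun i => a ((tnth o i).1.1, (tnth o i).2))].
have mB : measurable B.
  have mO i : measurable_fun setT (fun o : n.-tuple (R * bool * k.-tuple R) => tnth o i).
    exact: measurable_tnth.
  have mO1 i := measurableT_comp measurable_fst (mO i).
  have mU i := measurableT_comp measurable_fst (mO1 i).
  have mdelta i := measurableT_comp measurable_snd (mO1 i).
  have mZ i := measurableT_comp measurable_snd (mO i).
  rewrite -[X in measurable X]setTI.
  apply: (@measurable_large_deviation _ _ R n _ _ _ tau M eta mu mU _ mdelta) => // i.
  exact: (measurableT_comp ma (measurable_fun_pair (mU i) (mZ i))).
have -> : [set w | 4 * Num.sqrt (2 * eta) <=
               Num.sqrt n%:R * H_tau w * G_tau w ^+ 2 / M * `|muhat w - mu|] =
   (fun w => [tuple observation (Ts i) (Cs i) (Zs i) w | i < n]) @^-1` B.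
  have H w : (4 * Num.sqrt (2 * eta) <=
               Num.sqrt n%:R * H_tau w * G_tau w ^+ 2 / M * `|muhat w - mu|) =
     large_deviation tau M eta mu (U w) (delta w) (fun i => a (U w i, Zs i w)).
    rewrite /large_deviation /G_tau left_limit_kaplan_meier; congr (_ <= _ * `|_ - _|).
    rewrite /muhat /mu_hat; congr (_ * _); apply: eq_bigr => i _.
    rewrite left_limit_kaplan_meier.
    case E1: (delta w i); last by rewrite !mul0r.
    have -> : U w i = Ts i w by rewrite /U /observed_time min_l.
    rewrite aE //; split=> /=; last exact: ZsZ.
    by rewrite in_itv /= Ts_tau.
  have O w : B [tuple observation (Ts i) (Cs i) (Zs i) w | i < n] =
      large_deviation tau M eta mu (U w) (delta w) (fun i => a (U w i, Zs i w)) :> Prop.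
    rewrite /B /=; congr (is_true (large_deviation _ _ _ _ _ _ _)); apply/funext => i;
      by rewrite tnth_mktuple.
  by apply/funext => w; rewrite /= H /preimage /= O.
have lawE A : measurable A -> P (observation T C Z @^-1` A) = Q (obs @^-1` A).
  by rewrite QE.
rewrite (iid_copies_law Qn_iid iid mobservation mobs lawE mB).
have := deviation_probability (t := fst) (a := a) (tau := tau) (M := M) (eta := eta) Qn_iid Q_indep measurable_fst ma Q_no_tie Q_tau aM n0 M0 eta0.
rewrite -muE => h.
apply: le_trans (_ : (2 * expR (- eta))%:E <= _)%E; last first.
  by rewrite lee_fin ler_wpM2r ?expR_ge0 //; lra.
apply: le_trans h; rewrite le_eqVlt; apply/orP; left; apply/eqP; congr (Qn _).
apply/funext => x; rewrite /B /preimage /=; congr is_true.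
have -> : (fun i => (tnth [tuple obs (tnth x i) | i < n] i).1.1) =
    (fun i => Num.min (tnth x i).1.1 (tnth x i).2).
  by apply/funext => i; rewrite tnth_mktuple.
have -> : (fun i => (tnth [tuple obs (tnth x i) | i < n] i).1.2) =
    (fun i => (tnth x i).1.1 <= (tnth x i).2).
  by apply/funext => i; rewrite tnth_mktuple.
apply: eq_large_deviation => i tc; rewrite tnth_mktuple /= min_l //.
by case: (tnth x i).1.
Qed.
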